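(* Let $\mathcal H$ be a real Hilbert space, let $L,M:\mathcal H\to\mathcal H$ be linear self-adjoint positive definite maps, let $A:\mathcal H\to 2^{\mathcal H}$ be maximally monotone, let $B:\mathcal H\to\mathcal H$ be co-coercive w.r.t. $L$, and assume $S:=(A+B)^{-1}(0)\neq\emptyset$. Let $(x_n),(z_n),(v_n)$ be generated by CRIFBA (defined in the context) with parameters $s_1,s_0,\nu_0\in[0,\infty)$ and $e,\lambda,w\in(0,\infty)$ satisfying $$2s_1<s_0<e,\qquad 0<w<1 .$$ Suppose furthermore that one of the following two conditions holds: (a) there exists $\delta>0$ such that $\lambda\|L\|\le 4\delta$ and $M-\frac{\delta}{w(1-w)}I$ is positive definite; (b) $M-\frac{\lambda}{w(1-w)}L$ is positive definite. Write $\dot u_n=u_n-u_{n-1}$ for any sequence $(u_n)$, and set $y_n=x_n+\left(1-\frac1w\right)v_n$. Then: 1. $\|\dot x_{n+1}\|_M^2=o(n^{-2})$, $\sum_n n\|\dot x_{n+1}\|_M^2<\infty$, $\sum_n n^2\|\dot x_{n+1}-\dot x_n\|_M^2<\infty$; 2. $\|v_n\|_M^2=o(n^{-2})$, $\sum_n n\|v_n\|_M^2<\infty$, $\sum_n n^2\|\dot v_{n+1}\|_M^2<\infty$; 3. $\|G_\lambda^M(x_n)\|_M^2=o(n^{-2})$, $\sum_n n\|G_\lambda^M(x_n)\|_M^2<\infty$; 4. $\|\dot y_{n+1}\|_M^2=o(n^{-2})$, $\sum_n n\|\dot y_{n+1}\|_M^2<\infty$; 5. $\|G_\lambda^M(y_n)\|_M^2=o(n^{-2})$,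 $\sum_n n\|G_\lambda^M(y_n)\|_M^2<\infty$. If, in addition, $M$ and $L$ are bounded, then: 6. there exists $\bar x\in S$ such that $(x_n,y_n)\rightharpoonup(\bar x,\bar x)$ weakly in $(\mathcal H,\|\cdot\|_M)^2$; 7. there exist $y_n^*\in(A+B)(y_n)$ such that $\|y_n^*\|_M^2=o(n^{-2})$ and $\sum_n n\|y_n^*\|_M^2<\infty$.
   Context: $\langle\cdot,\cdot\rangle$ and $\|\cdot\|$ are the inner product and norm of $\mathcal H$. A linear self-adjoint $\mathcal M:\mathcal H\to\mathcal H$ is positive definite if $\inf_{x\ne0}\langle \mathcal Mx,x\rangle/\|x\|^2>0$; then $\langle x,y\rangle_{\mathcal M}=\langle\mathcal Mx,y\rangle$ and $\|x\|_{\mathcal M}=\sqrt{\langle\mathcal Mx,x\rangle}$. $\|L\|=\sup_{\|x\|=1}\|Lx\|$. $B$ is co-coercive w.r.t. $L$ if $\langle Bx-By,x-y\rangle\ge\|Bx-By\|_{L^{-1}}^2$ for all $x,y\in\mathcal H$. For $\lambda>0$, $J_{\lambda M^{-1}A}=(I+\lambda M^{-1}A)^{-1}$ and $G_\lambda^M=\frac1\lambda\left(I-J_{\lambda M^{-1}A}\circ(I-\lambda M^{-1}B)\right)$. CRIFBA (corrected relaxed inertial forward-backward algorithm): choose $z_{-1},x_{-1},x_0\in\mathcal H$ arbitrarily, set $$\nu_n=s_1n+\nu_0,\quad \theta_n=1-\frac{e+s_1}{e+\nu_{n+1}},\quad \gamma_n=1-\frac{s_0}{e+\nu_{n+1}},$$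 and for $n\ge0$ compute $$v_n=z_{n-1}-x_n,\quad z_n=x_n+\theta_n(x_n-x_{n-1})+\gamma_nv_n,\quad x_{n+1}=(1-w)z_n+wJ_{\lambda M^{-1}A}\left(z_n-\lambda M^{-1}B(z_n)\right).$$
   Formalization: The rates in items 1–5 and 7 are proved for s_1>0 only (for s_1=0 they fail, e.g. for a skew A on l^2 with B=0); item 6 is proved for all s_1≥0. In item 7 the inclusion y_n^* ∈ (A+B)(y_n) is claimed for n≥1 only, since y_0 is an arbitrary point. *)

(* Defs.v *)
From HB Require Import structures.
From mathcomp Require Import all_boot all_order all_algebra.
From mathcomp Require Import all_classical all_reals all_analysis.

Set Implicit Arguments.
Unset Strict Implicit.
Unset Printing Implicit Defensive.

Import Order.TTheory GRing.Theory Num.Theory.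
Import numFieldNormedType.Exports.

Local Open Scope classical_set_scope.
Local Open Scope ring_scope.

(* A real Hilbert space is a complete normed space [H] together with
   [dot : {dot H for @idfun R}] such that [dot x x = `|x| ^+ 2]; completeness is
   part of [completeNormedModType]. *)

Section Operators.
Context {R : realType} {H : completeNormedModType R}.
Variable dot : H -> H -> R.
Implicit Types (T : H -> H) (A : H -> set H).

Definition self_adjoint T := forall x y, dot (T x) y = dot x (T y).

(* Infimum and supremum are taken in [\bar R], so that no value is invented for
   an unbounded [T]; on the zero space they range over the empty set. *)
Definition rayleigh_inf T : \bar R :=
  ereal_inf [set (dot (T x) x / `|x| ^+ 2)%:E | x in [set x : H | x != 0]].

Definition positive_definite T : Prop := (0 < rayleigh_inf T)%E.

Definition op_norm T : \bar R :=
  ereal_sup [set `|T x|%:E | x in [set x : H | `|x| = 1]].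

Definition bounded_op T : Prop := (op_norm T < +oo)%E.

Definition dot_of T (x y : H) : R := dot (T x) y.

Definition norm_of T (x : H) : R := Num.sqrt (dot (T x) x).

(* The two-sided inverse of [T] when [T] is bijective, as linear self-adjoint
   positive definite operators are. *)
Definition inv_op T : H -> H := 'pinv_(fun=> 0) setT T.

Definition cocoercive (L B : H -> H) :=
  forall x y,
    norm_of (inv_op L) (B x - B y) ^+ 2 <= dot (B x - B y) (x - y).

Definition monotone A :=
  forall x y u v, A x u -> A y v -> 0 <= dot (u - v) (x - y).

Definition maximally_monotone A :=
  monotone A /\
  forall A', monotone A' -> (forall x, A x `<=` A' x) ->
    forall x, A' x `<=` A x.

Definition set_op_add A (B : H -> H) : H -> set H :=
  fun x => [set a + B x | a in A x].

Definition set_op_inv A : H -> set H := fun y => [set x | A x y].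

Definition zeros A : set H := set_op_inv A 0.

(* [resolvent lambda M A] selects a point of the set [(I + lambda M^-1 A)^-1 z];
   that set is a singleton (Minty) when [A] is maximally monotone, [0 < lambda]
   and [M] is linear, self-adjoint and positive definite. *)
Definition resolvent (lambda : R) (M : H -> H) A (z : H) : H :=
  xget 0 (set_op_inv
    (fun x => [set x + lambda *: inv_op M a | a in A x]) z).

Definition forward_backward (lambda : R) (M : H -> H) A (B : H -> H) (z : H) : H :=
  resolvent lambda M A (z - lambda *: inv_op M (B z)).

Definition residual (lambda : R) (M : H -> H) A (B : H -> H) (z : H) : H :=
  lambda^-1 *: (z - forward_backward lambda M A B z).

End Operators.

Section Algorithm.
Context {R : realType} {H : completeNormedModType R}.

Definition nu (s1 nu0 : R) (n : nat) : R := s1 * n%:R + nu0.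

Definition theta (e s1 nu0 : R) (n : nat) : R :=
  1 - (e + s1) / (e + nu s1 nu0 n.+1).

Definition gamma (e s0 s1 nu0 : R) (n : nat) : R :=
  1 - s0 / (e + nu s1 nu0 n.+1).

(* [seq_prev a u n] is $u_{n-1}$, with $u_{-1} = a$. *)
Definition seq_prev {V : Type} (a : V) (u : nat -> V) (n : nat) : V :=
  if n is m.+1 then u m else a.

(* [zm1] and [xm1] are $z_{-1}$ and $x_{-1}$; the starting points [zm1], [xm1]
   and [x 0] are unconstrained. *)
Definition crifba (M : H -> H) (A : H -> set H) (B : H -> H)
    (e lambda w s0 s1 nu0 : R) (zm1 xm1 : H) (x z v : nat -> H) : Prop :=
  forall n : nat,
    [/\ v n = seq_prev zm1 z n - x n,
        z n = x n + theta e s1 nu0 n *: (x n - seq_prev xm1 x n)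
                  + gamma e s0 s1 nu0 n *: v n
      & x n.+1 = (1 - w) *: z n + w *: forward_backward lambda M A B (z n)].

End Algorithm.

Section Asymptotics.
Context {R : realType}.

(* The term of index 0 of the comparison sequence is [0^-1 = 0], which is
   immaterial at infinity. *)
Definition o_n2 (u : nat -> R) : Prop :=
  (u : nat -> R^o) =o_\oo ((fun n => n%:R ^- 2) : nat -> R^o).

(* For nonnegative [u]: the series of general term $n^k u_n$ converges. *)
Definition summable_pow (k : nat) (u : nat -> R) : Prop :=
  (\sum_(0 <= n <oo) (n%:R ^+ k * u n)%:E < +oo)%E.

Definition prod_dot {V W : Type} (f : V -> V -> R) (g : W -> W -> R)
    (p q : V * W) : R := f p.1 q.1 + g p.2 q.2.

Definition weakly_cvg {V : Type} (f : V -> V -> R) (u : nat -> V) (l : V) : Prop :=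
  forall h, f (u n) h @[n --> \oo] --> f l h.

End Asymptotics.

(* Main.v *)
(* All estimates take place in [H] with the inner product <x, y>_M. Minty's
   theorem for [lambda M^-1 A] makes the resolvent total, and either condition
   on [lambda] makes T := w lambda G firmly nonexpansive for <., .>_M, its zeros
   being those of A + B. The scheme reads x_(n+1) = z_n - T z_n, v_(n+1) = T z_n.
   With d_n = x_n - x_(n-1) and a_n = e + nu_n, for every zero q of T the vector
   p_n = a_n (d_n + v_n) + e (x_(n-1) - q) satisfies
   p_(n+1) = p_n - (s0 - s1) v_n, and the energy
   |p_n|^2 + ((s0 - s1) / s0) a_n^2 |d_n|^2 decreases by at least
   c a_n (|d_n|^2 + |v_n|^2) + c' a_(n+1)^2 |v_(n+1) - v_n|^2.
   The sequences a_n^2 |d_n|^2 and a_n^2 |d_n + v_n|^2 increase by summable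
   amounts and are summable against 1 / a_n, hence tend to 0, which gives all
   the rates. Consequently |x_n - q| converges for every zero q, and Opial's
   lemma yields weak convergence. *)

Require Import Defs.
From HB Require Import structures.
From mathcomp Require Import all_boot all_order all_algebra.
From mathcomp Require Import all_classical all_reals all_analysis.
From mathcomp Require Import ring lra.

Set Implicit Arguments.
Unset Strict Implicit.
Unset Printing Implicit Defensive.

Import Order.TTheory GRing.Theory Num.Theory.
Import numFieldNormedType.Exports.

Local Open Scope classical_set_scope.
Local Open Scope ring_scope.

(** * Hilbert forms and Minty's theorem *)

(** Completeness is expressed through the form itself, not through a given topology, so that the
    same lemmas serve the ambient inner product, the forms of [L] and [M], and the product form on
    pairs. *)
Record hilbert_form (R : realType) (V : lmodType R) (b : V -> V -> R) : Prop :=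
  HilbertForm {
    hfC : forall x y, b x y = b y x;
    hfDl : forall x y z, b (x + y) z = b x z + b y z;
    hfZl : forall a x z, b (a *: x) z = a * b x z;
    hf_ge0 : forall x, 0 <= b x x;
    hf_eq0 : forall x, b x x = 0 -> x = 0;
    hf_complete : forall u : nat -> V,
      (forall eps, 0 < eps -> exists N, forall n m, (N <= n)%N -> (N <= m)%N ->
         b (u n - u m) (u n - u m) < eps) ->
      exists l, b (u n - l) (u n - l) @[n --> \oo] --> 0 }.

Lemma cvg_of_sqr_le (R : realType) (f g : nat -> R) (l : R) :
  g n @[n --> \oo] --> 0 -> (forall n, (f n - l) ^+ 2 <= g n) ->
  f n @[n --> \oo] --> l.
Proof.
move=> g0 fg; apply/cvgrPdist_lt => eps eps0.
have e2 : 0 < eps ^+ 2 by rewrite exprn_gt0.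
move/cvgrPdist_lt : g0 => /(_ _ e2); apply: filterS => n.
rewrite sub0r normrN => gn; rewrite distrC.
rewrite -(@ltr_pXn2r _ 2) ?nnegrE ?normr_ge0 ?(ltW eps0)//.
rewrite real_normK ?num_real//.
by apply: le_lt_trans (fg n) _; exact: le_lt_trans (ler_norm _) gn.
Qed.

Section HilbertForm.
Context {R : realType} {V : lmodType R} {b : V -> V -> R}.
Context (hb : hilbert_form b).

Lemma hfNl x y : b (- x) y = - b x y.
Proof. by rewrite -(scaleN1r x) (hfZl hb) mulN1r. Qed.

Lemma hfDr x y z : b x (y + z) = b x y + b x z.
Proof. by rewrite (hfC hb x) (hfDl hb) !(hfC hb x). Qed.

Lemma hfZr a x y : b x (a *: y) = a * b x y.
Proof. by rewrite (hfC hb x) (hfZl hb) (hfC hb x). Qed.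

Lemma hfNr x y : b x (- y) = - b x y.
Proof. by rewrite (hfC hb x) hfNl (hfC hb x). Qed.

Lemma hf0l x : b 0 x = 0.
Proof. by rewrite -(scale0r 0) (hfZl hb) mul0r. Qed.

Definition hfE := (hfDl hb, hfDr, hfZl hb, hfZr, hfNl, hfNr).

Lemma hf_cauchy_schwarz x y : b x y ^+ 2 <= b x x * b y y.
Proof.
have [y0|y0] := eqVneq (b y y) 0.
  by rewrite (hf_eq0 hb y0) [b x 0](hfC hb) !hf0l expr0n/= mulr0.
have yp : 0 < b y y by rewrite lt_def y0 (hf_ge0 hb).
have := hf_ge0 hb (b y y *: x - b x y *: y).
have -> : b (b y y *: x - b x y *: y) (b y y *: x - b x y *: y) =
    b y y * (b x x * b y y - b x y ^+ 2).
  by rewrite !hfE (hfC hb y x); ring.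
by rewrite pmulr_rge0// subr_ge0.
Qed.

Lemma hf_sqrD x y : b (x + y) (x + y) = b x x + 2 * b x y + b y y.
Proof. by rewrite !hfE (hfC hb y x); ring. Qed.

Lemma hf_sqrD_le x y : b (x + y) (x + y) <= 2 * (b x x + b y y).
Proof. by have := hf_ge0 hb (x - y); rewrite !hfE (hfC hb y x); lra. Qed.

Lemma hf_sqrZ a x : b (a *: x) (a *: x) = a ^+ 2 * b x x.
Proof. by rewrite !hfE; ring. Qed.

Lemma hf_sqrN x : b (- x) (- x) = b x x.
Proof. by rewrite !hfE opprK. Qed.

Lemma hf_cvg_dot (u : nat -> V) l h :
  b (u n - l) (u n - l) @[n --> \oo] --> 0 ->
  b (u n) h @[n --> \oo] --> b l h.
Proof.
move=> ul.
apply: (@cvg_of_sqr_le _ _ (fun n => b (u n - l) (u n - l) * b h h)).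
  by rewrite -(mul0r (b h h)); apply: cvgM => //; exact: cvg_cst.
by move=> n; rewrite -hfNl -(hfDl hb); exact: hf_cauchy_schwarz.
Qed.

Lemma hf_cvg_sqr (u : nat -> V) l :
  b (u n - l) (u n - l) @[n --> \oo] --> 0 ->
  b (u n) (u n) @[n --> \oo] --> b l l.
Proof.
move=> ul.
have -> : (fun n => b (u n) (u n)) =
    (fun n => b (u n - l) (u n - l) + (2 * b (u n) l - b l l)).
  by apply/funext => n; rewrite !hfE (hfC hb l (u n)); ring.
rewrite [X in _ --> X](_ : b l l = 0 + (2 * b l l - b l l)); last by ring.
apply: cvgD => //; apply: cvgB; last exact: cvg_cst.
by apply: cvgM; [exact: cvg_cst|exact: hf_cvg_dot].
Qed.

(* [K] plays the role of the epigraph of a convex lower semicontinuous [f];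
   the conclusion is the optimality condition for [f + |.|^2 / 2]. Midpoint
   convexity makes every minimizing sequence Cauchy. *)
Lemma closed_convex_min (K : V -> R -> Prop) (m : R) :
  (exists x t, K x t) ->
  (forall x t y s (a : R), 0 <= a <= 1 -> K x t -> K y s ->
     K ((1 - a) *: x + a *: y) ((1 - a) * t + a * s)) ->
  (forall u t x (s : R), (forall n, K (u n) (t n)) ->
     b (u n - x) (u n - x) @[n --> \oo] --> 0 -> t n @[n --> \oo] --> s ->
     K x s) ->
  (forall x t, K x t -> m <= t + b x x / 2) ->
  exists x0 t0, K x0 t0 /\ forall x t, K x t -> t0 <= t + b x0 (x - x0).
Proof.
move=> [xi [ti Ki]] Kconv Kclosed Km.
pose S := [set r | exists x t, K x t /\ r = t + b x x / 2].
have Sinf : has_inf S.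
  split; first by exists (ti + b xi xi / 2), xi, ti.
  by exists m => _ [x [t [Kxt ->]]]; exact: Km.
set mu := inf S.
have muP x t : K x t -> mu <= t + b x x / 2.
  by move=> Kxt; apply: ge_inf; [exact: Sinf.2|exists x, t].
have seqP n : exists p : V * R, K p.1 p.2 /\ p.2 + b p.1 p.1 / 2 < mu + n.+1%:R^-1.
  have [|_ [x [t [Kxt ->]]] h] := @inf_adherent _ S n.+1%:R^-1 _ Sinf.
    by rewrite invr_gt0.
  by exists (x, t).
have [p pP] := choice seqP.
pose u n := (p n).1; pose t n := (p n).2.
have Kut n : K (u n) (t n) by case: (pP n).
have val_lt n : t n + b (u n) (u n) / 2 < mu + n.+1%:R^-1 by case: (pP n).
(* Parallelogram identity: the midpoint of two points of the minimizing sequence has value at least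
   [mu], while each endpoint exceeds [mu] by at most its tolerance. *)
have gap n k : b (u n - u k) (u n - u k) <= 4 * (n.+1%:R^-1 + k.+1%:R^-1).
  have half : 0 <= (2^-1 : R) <= 1 by apply/andP; split; lra.
  have := muP _ _ (Kconv _ _ _ _ _ half (Kut n) (Kut k)).
  have := val_lt n; have := val_lt k.
  rewrite !hfE (hfC hb (u k) (u n)).
  have -> : (1 - 2^-1 : R) = 2^-1 by lra.
  by move: n.+1%:R^-1 k.+1%:R^-1 => r1 r2; lra.
have [|x0 x0P] := @hf_complete _ _ _ hb u.
  move=> eps eps0.
  have e8 : 0 < eps / 8 by lra.
  move/cvgrPdist_lt : (@cvg_harmonic R) => /(_ _ e8)[N _ NP].
  exists N => n k Nn Nk; apply: le_lt_trans (gap n k) _.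
  have := NP n Nn; have := NP k Nk; rewrite /harmonic /= !sub0r !normrN.
  rewrite !ger0_norm ?invr_ge0//.
  by move: n.+1%:R^-1 k.+1%:R^-1 => r1 r2; lra.
have valc : t n + b (u n) (u n) / 2 @[n --> \oo] --> mu.
  apply: (@squeeze_cvgr _ _ _ _ (fun=> mu) (fun n => mu + harmonic n)).
  - by apply: nearW => n; rewrite (muP _ _ (Kut n))/= ltW// val_lt.
  - exact: cvg_cst.
  - by rewrite -[X in _ --> X]addr0; apply: cvgD; [exact: cvg_cst|exact: cvg_harmonic].
(* The values tend to [mu] and the quadratic part converges along the strong limit [x0], so this is
   the only possible limit of [t n]. *)
pose t0 := mu - b x0 x0 / 2.
have tc : t n @[n --> \oo] --> t0.
  have -> : t = (fun n => (t n + b (u n) (u n) / 2) - b (u n) (u n) / 2).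
    by apply/funext => n; rewrite addrK.
  by apply: cvgB => //; apply: cvgM; [exact: hf_cvg_sqr|exact: cvg_cst].
have K0 : K x0 t0 by exact: Kclosed Kut x0P tc.
exists x0, t0; split => // x s Kxs.
rewrite leNgt; apply/negP => hlt.
set D := t0 - (s + b x0 (x - x0)).
have D0 : 0 < D by rewrite /D subr_gt0.
set q := b (x - x0) (x - x0).
have q0 : 0 <= q by exact: hf_ge0.
(* Moving a fraction [a] of the way to [(x, s)] lowers the value by [a * (D - a * q / 2)]. This
   choice ensures [a <= 1] and [a * q <= D], so the value would drop below [mu]. *)
pose a := D / (D + q).
have Dq : 0 < D + q by lra.
have a01 : 0 <= a <= 1.
  by rewrite /a divr_ge0 ?(ltW D0) ?(ltW Dq)//= ler_pdivrMr// mul1r; lra.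
have a0 : 0 < a by rewrite divr_gt0.
have aq : a * q <= D.
  by rewrite /a mulrAC ler_pdivrMr// ler_wpM2l ?(ltW D0)//; lra.
clearbody a.
have := muP _ _ (Kconv _ _ _ _ _ a01 K0 Kxs).
have -> : (1 - a) * t0 + a * s + b ((1 - a) *: x0 + a *: x) ((1 - a) *: x0 + a *: x) / 2
   = mu - a * (D - a * q / 2).
  by rewrite /D /q /t0 !hfE (hfC hb x x0); field.
have : 0 < a * (D - a * q / 2) by apply: mulr_gt0 => //; lra.
by lra.
Qed.

(** Riesz representation by minimizing |x|^2 / 2 - f x: the optimality condition tested at [x0 + h]
    and [x0 - h] gives both inequalities. The lower bound [- C] comes from the arithmetic-geometric
    inequality applied to [C] and |x|^2. *)
Lemma hf_riesz (f : V -> R) (C : R) : 0 <= C ->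
  (forall a x y, f (a *: x + y) = a * f x + f y) ->
  (forall x, f x ^+ 2 <= C * b x x) ->
  exists l, forall x, f x = b l x.
Proof.
move=> C0 flin fC.
have f0 : f 0 = 0.
  by have := flin 1 0 0; rewrite scaler0 addr0 mul1r; lra.
have fD x y : f (x + y) = f x + f y by rewrite -{1}(scale1r x) flin mul1r.
have fZ a x : f (a *: x) = a * f x by rewrite -(addr0 (a *: x)) flin f0 addr0.
have fN x : f (- x) = - f x by rewrite -(scaleN1r x) fZ mulN1r.
have [||||x0 [t0 [K0 opt]]] := @closed_convex_min (fun x t => - f x <= t) (- C).
- by exists 0, 0; rewrite f0 oppr0.
- move=> x t y s a /andP[a0 a1] h1 h2; rewrite fD !fZ.
  have : 0 <= (1 - a) * (t + f x) by apply: mulr_ge0; lra.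
  have : 0 <= a * (s + f y) by apply: mulr_ge0; lra.
  by lra.
- move=> u t x s h ux ts.
  have fu : f (u n) @[n --> \oo] --> f x.
    apply: (@cvg_of_sqr_le _ _ (fun n => C * b (u n - x) (u n - x))).
      by rewrite -(mulr0 C); apply: cvgM => //; exact: cvg_cst.
    by move=> n; rewrite -fN -fD.
  by apply: (ler_cvg_to (cvgN fu) ts); exact: nearW.
- move=> x t h; have fx := fC x; have q0 := hf_ge0 hb x.
  suff : f x <= (C + b x x) / 2 by lra.
  apply: le_trans (ler_norm _) _.
  rewrite -(@ler_pXn2r _ 2) ?nnegrE//; last by lra.
  rewrite real_normK ?num_real//; apply: le_trans fx _.
  by have := sqr_ge0 (C - b x x); rewrite !expr2; lra.
- exists x0 => h.
  have := opt (x0 + h) _ (lexx _); have := opt (x0 - h) _ (lexx _).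
  rewrite !fD !fN ![_ - x0]addrAC !subrr !add0r !hfE; lra.
Qed.

End HilbertForm.

Lemma hilbert_form_prod (R : realType) (V : lmodType R) (b : V -> V -> R) :
  hilbert_form b -> hilbert_form (prod_dot b b : V * V -> V * V -> R).
Proof.
move=> hb; split; rewrite /prod_dot.
- by move=> x y; rewrite (hfC hb x.1) (hfC hb x.2).
- by move=> x y z /=; rewrite !(hfDl hb) addrACA.
- by move=> a x z /=; rewrite !(hfZl hb) mulrDr.
- by move=> x; apply: addr_ge0; exact: hf_ge0 hb _.
- move=> [x y] /= h; have := hf_ge0 hb x; have := hf_ge0 hb y => h1 h2.
  have x0 : b x x = 0 by lra.
  have y0 : b y y = 0 by lra.
  by rewrite (hf_eq0 hb x0) (hf_eq0 hb y0).
- move=> u uC.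
  have [|l1 l1P] := @hf_complete _ _ _ hb (fun n => (u n).1).
    move=> eps /uC[N NP]; exists N => n m Nn Nm.
    have := NP n m Nn Nm; have := hf_ge0 hb ((u n).2 - (u m).2).
    by rewrite /=; lra.
  have [|l2 l2P] := @hf_complete _ _ _ hb (fun n => (u n).2).
    move=> eps /uC[N NP]; exists N => n m Nn Nm.
    have := NP n m Nn Nm; have := hf_ge0 hb ((u n).1 - (u m).1).
    by rewrite /=; lra.
  by exists (l1, l2); rewrite -(addr0 0); exact: cvgD.
Qed.

(* Following Simons and Zalinescu: [K] is the epigraph of the Fitzpatrick
   function of [T], minimized together with [(|x|^2 + |u|^2) / 2]. *)
Lemma minty_zero (R : realType) (V : lmodType R) (b : V -> V -> R)
    (T : V -> V -> Prop) : hilbert_form b ->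
  (forall x u y v, T x u -> T y v -> 0 <= b (u - v) (x - y)) ->
  (forall x u, (forall y v, T y v -> 0 <= b (u - v) (x - y)) -> T x u) ->
  exists p, T p (- p).
Proof.
move=> hb Tmono Tmax; have hb2 := hilbert_form_prod hb.
pose K (p : V * V) t := forall y v, T y v -> b p.1 v + b y p.2 - b y v <= t.
have KT y v : T y v -> K (y, v) (b y v).
  move=> Tyv y' v' Tyv'; have := Tmono _ _ _ _ Tyv Tyv' => /=.
  by rewrite !(hfE hb) (hfC hb v y) (hfC hb v y') (hfC hb v' y) (hfC hb v' y'); lra.
(* The Fitzpatrick function dominates the duality pairing: a point violating this would be
   monotonically related to the whole graph, hence lie on it by maximality, which is absurd. *)
have Kge p t : K p t -> b p.1 p.2 <= t.
  move=> Kpt; rewrite leNgt; apply/negP => lt_t.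
  suff Tp : T p.1 p.2 by have := Kpt _ _ Tp; lra.
  apply: Tmax => y v Tyv; have := Kpt _ _ Tyv.
  by rewrite !(hfE hb) (hfC hb p.2 p.1) (hfC hb p.2 y) (hfC hb v p.1) (hfC hb v y); lra.
have [||||[x0 u0] [t0 [K0 opt]]] := @closed_convex_min _ _ _ hb2 K 0.
- have [[x [u Txu]]|noT] := pselect (exists x u, T x u).
    by exists (x, u), (b x u); exact: KT.
  (* With an empty graph maximality holds vacuously at [(0, 0)], which would put that point on the
     graph. *)
  exfalso; apply: (noT); exists 0, 0; apply: Tmax => y v Tyv.
  by case: noT; exists y, v.
- move=> x t y s a /andP[a0 a1] Kx Ky y' v' Tyv /=.
  have : 0 <= (1 - a) * (t - (b x.1 v' + b y' x.2 - b y' v')).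
    by apply: mulr_ge0; [lra|rewrite subr_ge0; exact: Kx].
  have : 0 <= a * (s - (b y.1 v' + b y' y.2 - b y' v')).
    by apply: mulr_ge0; [lra|rewrite subr_ge0; exact: Ky].
  by rewrite !(hfE hb); lra.
- move=> u t x s Ku ux ts y v Tyv.
  have uvy : prod_dot b b (u n) (v, y) - b y v @[n --> \oo] -->
      b x.1 v + b y x.2 - b y v.
    have -> : b x.1 v + b y x.2 - b y v = prod_dot b b x (v, y) - b y v.
      by rewrite /prod_dot /= (hfC hb y).
    by apply: cvgB; [exact: (hf_cvg_dot hb2)|exact: cvg_cst].
  apply: (ler_cvg_to uvy ts).
  by apply: nearW => n; rewrite /prod_dot /= (hfC hb _ y); exact: Ku.
- move=> [x u] t Kxt; have := Kge _ _ Kxt; have := hf_ge0 hb (x + u).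
  by rewrite /prod_dot /= !(hfE hb) (hfC hb u x); lra.
have t0ge := Kge _ _ K0.
(* Optimality at a graph point, combined with [Kge] at the minimizer. The right side is thus
   nonnegative, so [(- u0, - x0)] lies on the graph by maximality; taking that very point as
   [(y, v)] forces [x0 + u0 = 0]. *)
have key y v : T y v -> b (x0 + u0) (x0 + u0) <= b (- u0 - y) (- x0 - v).
  move=> Tyv; have := opt _ _ (KT _ _ Tyv); move: t0ge; rewrite /prod_dot /=.
  rewrite !(hfE hb) (hfC hb u0 x0) (hfC hb y x0) => h1 h2.
  rewrite /= in h1 h2 *; lra.
have T0 : T (- u0) (- x0).
  apply: Tmax => y v Tyv; rewrite (hfC hb).
  by apply: le_trans (key _ _ Tyv); exact: hf_ge0.
have := key _ _ T0; rewrite !subrr (hf0l hb) => h.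
have /(hf_eq0 hb)/eqP : b (x0 + u0) (x0 + u0) = 0.
  by apply/eqP; rewrite eq_le h (hf_ge0 hb).
rewrite addr_eq0 => /eqP x0E; exists x0.
by rewrite {1}x0E.
Qed.

(** Surjectivity of I + T, obtained from [minty_zero] for [T] with its values translated by
    [- z]. *)
Lemma minty (R : realType) (V : lmodType R) (b : V -> V -> R)
    (T : V -> V -> Prop) (z : V) : hilbert_form b ->
  (forall x u y v, T x u -> T y v -> 0 <= b (u - v) (x - y)) ->
  (forall x u, (forall y v, T y v -> 0 <= b (u - v) (x - y)) -> T x u) ->
  exists p, T p (z - p).
Proof.
move=> hb Tmono Tmax.
have [||p Tp] := @minty_zero _ _ _ (fun p u => T p (u + z)) hb.
- move=> x u y v Txu Tyv; have := Tmono _ _ _ _ Txu Tyv.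
  by rewrite opprD addrACA subrr addr0.
- move=> x u h; apply: Tmax => y v Tyv.
  have := h y (v - z); rewrite subrK => /(_ Tyv).
  by rewrite opprB addrA.
by exists p; rewrite addrC.
Qed.

(** * Weak limits and sequences with bounded sums *)

Lemma ultra_cvg_bounded (R : realType) (U : set_system nat) (f : nat -> R) (C : R) :
  UltraFilter U -> (forall n, `|f n| <= C) -> exists l : R, f n @[n --> U] --> l.
Proof.
move=> uU fC.
have [|l [_ lcl]] := @segment_compact _ (- C) C (f @ U) _.
  apply: (@filterS _ U _ setT); last exact: filterT.
  by move=> n _ /=; rewrite in_itv/= -ler_norml.
exists l => B Bl.
have [//|UB] := in_ultra_setVsetC (f @^-1` B) uU.
by have [y [By nBy]] := lcl (~` B) B UB Bl.
Qed.

(** If some neighbourhood had a preimage outside the filter, the trace of the filter on the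
    complement would extend to an ultrafilter along which convergence fails. Ultrafilters play the
    role of subsequences in what follows. *)
Lemma cvg_ultraP (R : realType) (f : nat -> R) (l : R) :
  (forall U : set_system nat, UltraFilter U -> \oo `<=` U -> f n @[n --> U] --> l) ->
  f n @[n --> \oo] --> l.
Proof.
move=> h B Bl; apply: contrapT => nB.
pose D := ~` (f @^-1` B).
have pD : ProperFilter (within D \oo).
  split; last exact: within_filter.
  move=> D0; apply: nB; move: D0; rewrite /within /= /nbhs /=.
  by apply: filterS => n nD; apply: contrapT => Dn; exact: (nD Dn).
have [U [uU DU]] := ultraFilterLemma pD.
have oU : \oo `<=` U.
  by move=> A oA; apply: DU; rewrite /within; apply: filterS oA => n An _.
have UD : U D by apply: DU; rewrite /within /=; apply: nearW.
have UB : U (f @^-1` B) by exact: h uU oU _ Bl.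
have : U set0 by rewrite -(setICr (f @^-1` B)); exact: filterI.
exact: filter_not_empty.
Qed.

(** Weak compactness of bounded sets: the scalar limits along [U] define a bounded linear functional
    of [h], which [hf_riesz] represents. *)
Lemma hf_weak_ultralimit (R : realType) (V : lmodType R) (b : V -> V -> R)
    (U : set_system nat) (x : nat -> V) (C : R) :
  hilbert_form b -> UltraFilter U -> (forall n, b (x n) (x n) <= C) ->
  exists l, forall h, b (x n) h @[n --> U] --> b l h.
Proof.
move=> hb uU xC.
have C0 : 0 <= C by apply: le_trans (xC 0); exact: hf_ge0.
have xhC n h : b (x n) h ^+ 2 <= C * b h h.
  apply: le_trans (hf_cauchy_schwarz hb _ _) _.
  by apply: ler_wpM2r => //; exact: hf_ge0.
have /choice[f fP] h : exists l : R, b (x n) h @[n --> U] --> l.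
  (* A bound free of square roots: t^2 <= q with q >= 0 implies |t| <= q + 1. *)
  apply: (@ultra_cvg_bounded _ _ _ (C * b h h + 1) uU) => n.
  have q0 : 0 <= C * b h h by apply: mulr_ge0 => //; exact: hf_ge0.
  rewrite -(@ler_pXn2r _ 2) ?nnegrE//; last by lra.
  rewrite real_normK ?num_real//; apply: le_trans (xhC n h) _.
  by rewrite sqrrD1 -subr_ge0; have := sqr_ge0 (C * b h h); lra.
have cvgu (g : nat -> R) (l l' : R) :
    g n @[n --> U] --> l -> g n @[n --> U] --> l' -> l = l'.
  by move=> h h'; apply: (cvg_unique _ h h').
have [||l lP] := @hf_riesz _ _ _ hb f C C0.
- move=> a y z; apply: (cvgu _ _ _ (fP _)).
  rewrite (_ : (fun n => _) = (fun n => a * b (x n) y + b (x n) z)); last first.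
    by apply/funext => n; rewrite !(hfE hb).
  by apply: cvgD => //; apply: cvgM => //; exact: cvg_cst.
- move=> h; apply: (ler_cvg_to (cvgM (fP h) (fP h)) (cvg_cst _)).
  by apply: nearW => n; exact: xhC.
- by exists l => h; rewrite -lP; exact: fP.
Qed.

(** For two weak cluster points [l0] and [l], the difference of the squared distances to them is
    affine in [b (x n) (l0 - l)], so the latter converges. Its limits along the two ultrafilters
    agree, hence |l0 - l|^2 = 0. *)
Lemma opial (R : realType) (V : lmodType R) (b : V -> V -> R)
    (S : V -> Prop) (x : nat -> V) (C : R) :
  hilbert_form b -> (forall n, b (x n) (x n) <= C) ->
  (forall q, S q -> cvgn (fun n => b (x n - q) (x n - q))) ->
  (forall U : set_system nat, UltraFilter U -> \oo `<=` U ->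
     forall l, (forall h, b (x n) h @[n --> U] --> b l h) -> S l) ->
  exists2 l, S l & forall h, b (x n) h @[n --> \oo] --> b l h.
Proof.
move=> hb xC dist_cvg clusterS.
have [U0 [uU0 oU0]] := ultraFilterLemma (eventually_filter).
have [l0 l0P] := hf_weak_ultralimit hb uU0 xC.
have S0 := clusterS _ uU0 oU0 _ l0P.
exists l0 => // h; apply: cvg_ultraP => U uU oU.
have [l lP] := hf_weak_ultralimit hb uU xC.
have Sl := clusterS _ uU oU _ lP.
suff -> : l0 = l by exact: lP.
have /cvg_ex[/= c cP] : cvgn (fun n => b (x n) (l0 - l)).
  have -> : (fun n => b (x n) (l0 - l)) = (fun n =>
      (b (x n - l) (x n - l) - b (x n - l0) (x n - l0) + (b l0 l0 - b l l)) / 2).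
    apply/funext => n; rewrite !(hfE hb) (hfC hb l0 (x n)) (hfC hb l (x n)).
    by field.
  apply: is_cvgM; last exact: is_cvg_cst.
  apply: is_cvgD; last exact: is_cvg_cst.
  by apply: is_cvgB; exact: dist_cvg.
have e0 : c = b l0 (l0 - l).
  apply: (@cvg_unique _ _ (b (x n) (l0 - l) @[n --> U0])); [by []| |exact: l0P].
  by move=> A /cP; exact: oU0.
have e1 : c = b l (l0 - l).
  apply: (@cvg_unique _ _ (b (x n) (l0 - l) @[n --> U])); [by []| |exact: lP].
  by move=> A /cP; exact: oU.
have /(hf_eq0 hb)/eqP : b (l0 - l) (l0 - l) = 0.
  by rewrite (hfDl hb) (hfNl hb) -e0 -e1 subrr.
by rewrite subr_eq0 => /eqP.
Qed.

(** For nonnegative terms this is summability, in the form that telescoping estimates deliver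
    directly. *)
Definition bounded_sums (R : realType) (h : nat -> R) :=
  exists C, forall n, \sum_(0 <= k < n) h k <= C.

Section BoundedSums.
Context {R : realType}.
Implicit Types (f g h u E : nat -> R).

Lemma bounded_sums_le f g :
  (forall n, f n <= g n) -> bounded_sums g -> bounded_sums f.
Proof.
by move=> fg [C hC]; exists C => n; apply: le_trans (hC n); exact: ler_sum.
Qed.

Lemma bounded_sumsD f g :
  bounded_sums f -> bounded_sums g -> bounded_sums (fun n => f n + g n).
Proof.
move=> [C hC] [D hD]; exists (C + D) => n; rewrite big_split/=.
by apply: lerD.
Qed.

Lemma bounded_sumsZ (c : R) f :
  0 <= c -> bounded_sums f -> bounded_sums (fun n => c * f n).
Proof.
move=> c0 [C hC]; exists (c * C) => n; rewrite -mulr_sumr.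
by apply: ler_wpM2l.
Qed.

Lemma bounded_sums_behead f :
  (forall n, 0 <= f n) -> bounded_sums f -> bounded_sums (fun n => f n.+1).
Proof.
move=> f0 [C hC]; exists C => n; have := hC n.+1.
by rewrite big_nat_recl//; have := f0 0%N; lra.
Qed.

Lemma bounded_sums_cons f : bounded_sums (fun n => f n.+1) -> bounded_sums f.
Proof.
move=> [C hC]; exists (`|f 0%N| + Num.max 0 C) => -[|n].
  by rewrite big_geq// addr_ge0// le_max lexx.
rewrite big_nat_recl// lerD ?ler_norm//.
by apply: le_trans (hC n) _; rewrite le_max lexx orbT.
Qed.

Lemma bounded_sums_descent E h :
  (forall n, 0 <= E n) -> (forall n, E n.+1 + h n <= E n) -> bounded_sums h.
Proof.
move=> E0 Eh; exists (E 0%N) => n.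
suff : \sum_(0 <= k < n) h k <= E 0%N - E n by have := E0 n; lra.
elim: n => [|n IH]; first by rewrite big_geq// subrr.
by rewrite big_nat_recr//=; have := Eh n; lra.
Qed.

Lemma bounded_sums_cvg h :
  (forall n, 0 <= h n) -> bounded_sums h -> cvgn (series h).
Proof.
move=> h0 [C hC]; apply: nondecreasing_is_cvgn.
  by apply: nondecreasing_series => n _ _.
by exists C => _ [n _ <-]; exact: hC.
Qed.

Lemma bounded_sums_nneseries h : (forall n, 0 <= h n) -> bounded_sums h ->
  (\sum_(0 <= n <oo) (h n)%:E < +oo)%E.
Proof.
move=> h0 [C hC]; apply: (@le_lt_trans _ _ C%:E); last exact: ltry.
apply: lime_le; first by apply: is_cvg_nneseries => n _ _; rewrite lee_fin.
by apply: nearW => n; rewrite sumEFin lee_fin.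
Qed.

Lemma harmonic_unbounded_sums (c : R) : 0 < c ->
  ~ bounded_sums (fun n => c * n.+1%:R^-1).
Proof.
move=> c0 bs; apply: (@dvg_harmonic R); apply: bounded_sums_cvg.
  by move=> n; rewrite invr_ge0.
have := bounded_sumsZ (ltW (_ : 0 < c^-1)) bs; rewrite invr_gt0 => /(_ c0).
by apply: bounded_sums_le => n; rewrite mulKf ?gt_eqF.
Qed.

(* [u n / a n] is summable while [1 / a n] is not, so [0] is the only
   possible limit. *)
Lemma almost_monotone_cvg0 u g (C K alpha beta : R) :
  (forall n, 0 <= u n) -> (forall n, 0 <= g n) -> 0 <= C -> 0 < K ->
  0 <= alpha -> 0 < beta ->
  (forall n, u n.+1 <= u n + C * g n) -> bounded_sums g ->
  (forall n, u n <= K * (alpha * n%:R + beta) * g n) ->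
  u n @[n --> \oo] --> 0.
Proof.
move=> u0 g0 C0 K0 al0 be0 ustep bsg ug.
pose G := series (fun n => C * g n).
have Gc : cvgn G.
  by apply: bounded_sums_cvg; [move=> n; exact: mulr_ge0|exact: bounded_sumsZ].
have [B hB] := bounded_sumsZ C0 bsg.
(* Subtracting the accumulated allowed increase leaves a nonincreasing sequence that is bounded
   below. *)
have wc : cvgn (fun n => u n - G n).
  apply: nonincreasing_is_cvgn.
    apply/nonincreasing_seqP => n.
    by rewrite /G /series /= big_nat_recr//=; have := ustep n; lra.
  exists (- B) => _ [n _ <-]; have := hB n; have := u0 n.
  by rewrite /G /series /=; lra.
have /cvg_ex[/= l ul] : cvgn u.
  have -> : u = (fun n => (u n - G n) + G n) by apply/funext => n; rewrite subrK.
  exact: is_cvgD.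
have l0 : 0 <= l.
  by apply: (ler_cvg_to (cvg_cst _) ul); apply: nearW => n; exact: u0.
have [<-//|l1] := eqVneq l 0.
have lp : 0 < l by rewrite lt_def l1.
have l2 : 0 < l / 2 by lra.
move/cvgrPdist_lt : ul => /(_ _ l2)[N _ NP].
exfalso.
(* If the limit [l] were positive, then l / 2 < u (n + N) <= A (n + 1) g (n + N), so the shifted [g]
   would dominate a multiple of the harmonic series. *)
pose A := K * (alpha * N.+1%:R + beta).
have A0 : 0 < A by apply: mulr_gt0 => //; apply: ltr_wpDl => //; exact: mulr_ge0.
have c0 : 0 < l / 2 / A by exact: divr_gt0.
apply: (harmonic_unbounded_sums c0).
have bsgN m : bounded_sums (fun n => g (n + m)%N).
  elim: m => [|m IH]; first by under [fun _ => _]funext do rewrite addn0.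
  apply: bounded_sums_le (bounded_sums_behead (fun n => g0 _) IH) => n.
  by rewrite addSnnS.
apply: bounded_sums_le (bsgN N) => n.
have un : l / 2 < u (n + N)%N.
  have := NP (n + N)%N (leq_addl _ _); rewrite /= => /ltr_distlDr; lra.
have an : K * (alpha * (n + N)%:R + beta) <= A * n.+1%:R.
  rewrite /A -mulrA ler_pM2l// -!natr1 natrD.
  have n0 : 0 <= (n%:R : R) by []. have N0 : 0 <= (N%:R : R) by [].
  have := mulr_ge0 (mulr_ge0 al0 n0) N0; have := mulr_ge0 (ltW be0) n0.
  by have := mulr_ge0 al0 n0; lra.
have n1 : 0 < (n.+1%:R : R) by [].
rewrite ler_pdivrMr// ler_pdivrMr//.
rewrite (_ : _ * n.+1%:R * A = A * n.+1%:R * g (n + N)%N); last first.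
  by rewrite mulrC mulrA mulrAC.
apply: le_trans (ltW un) (le_trans (ug _) _).
by rewrite ler_wpM2r.
Qed.

End BoundedSums.

(** * Energy estimates *)

(** Testing against all vectors reduces vector identities to scalar ones, which linear arithmetic
    settles. *)
Lemma hf_ext (R : realType) (V : lmodType R) (b : V -> V -> R) (x y : V) :
  hilbert_form b -> (forall h, b x h = b y h) -> x = y.
Proof.
move=> hb xy; apply/eqP; rewrite -subr_eq0; apply/eqP; apply: (hf_eq0 hb).
by rewrite (hfDl hb) (hfNl hb) xy subrr.
Qed.

(* [X], [Y], [Z] stand for [|d|^2], [|v|^2], [<v, d>], and [q] for [e / s0]. *)
Lemma energy_form_ge (R : realType) (a e s0 s1 q c X Y Z : R) :
  0 < e -> 0 <= s1 -> s1 < s0 -> s0 < e -> e <= a ->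
  q * s0 = e -> c * (2 * e) = e - s0 -> 0 <= X -> 0 <= Y ->
  0 <= X + Y + 2 * Z -> 0 <= 4 * X + Y + 4 * Z ->
  (s0 - s1) * (c * a * (X + Y)) <= (s0 - s1) *
    (4 * (a - e) * Z + (2 * a - (s0 - s1) - s0) * Y + q * (2 * a - e) * X).
Proof.
move=> e0 s10 s1s s0e ea qE cE X0 Y0 h1 h2.
rewrite ler_pM2l ?subr_gt0//.
have s00 : 0 < s0 by lra.
have c0 : 0 <= c.
  by rewrite -(@pmulr_lge0 _ (2 * e)); lra.
have c1 : c <= 2^-1 by rewrite -(@ler_pM2r _ (2 * e)); lra.
have q1 : 1 <= q by rewrite -(@ler_pM2r _ s0); lra.
have q3 : 3 * c <= 2 * (q - 1).
  rewrite -(@ler_pM2r _ (2 * e)); last by lra.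
  have : 3 * (q * s0 - s0) <= 4 * (q * s0) * (q - 1).
    have : 0 <= (q - 1) * (s0 * (4 * q - 3)).
      by apply: mulr_ge0; [lra|apply: mulr_ge0; lra].
    by lra.
  have -> : 3 * c * (2 * e) = 3 * (e - s0) by rewrite -mulrA cE.
  by rewrite -qE; lra.
(* Here c = (e - s0) / (2e). Once the factor [s0 - s1] is removed, right side minus left side is
   exactly [2 * A1 + A2 + A3 + A4 + A5]; [A1] and [A2] carry |v + d|^2 and |v + 2d|^2. *)
have A1 : 0 <= (1 - c) * ((a - e) * (X + Y + 2 * Z)).
  by apply: mulr_ge0; [lra|apply: mulr_ge0 => //; lra].
have A2 : 0 <= c * ((a - e) * (4 * X + Y + 4 * Z)).
  by apply: mulr_ge0; [lra|apply: mulr_ge0 => //; lra].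
have A3 : 0 <= X * ((a - e) * (2 * (q - 1) - 3 * c)).
  by apply: mulr_ge0; [lra|apply: mulr_ge0 => //; lra].
have A4 : 0 <= X * (e * (q - c)).
  by apply: mulr_ge0; [lra|apply: mulr_ge0 => //; lra].
have A5 : 0 <= Y * (2 * (e - s0) + s1 - c * e).
  by apply: mulr_ge0; lra.
by lra.
Qed.

(** * Energy decrease for an abstract inertial recursion *)

Section Recursion.
Context {R : realType} {V : lmodType R} {b : V -> V -> R}.
Context (hb : hilbert_form b).
Context (e s0 s1 a0 : R) (x d v : nat -> V).
(** In the application [a m] is e + nu_(m+1), [d m] is x_(m+1) - x_m and [v m] is v_(m+1). With this
    shift by one the arbitrary x_(-1) and z_(-1) enter only through z_0. *)
Let a m := s1 * m%:R + a0.
Context (e_gt0 : 0 < e) (s1_ge0 : 0 <= s1) (s1_lt : s1 < s0) (s0_lt : s0 < e).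
Context (e_le : e <= a0).
Context (xS : forall m, x m.+1 = x m + d m).
Context (rec : forall m, a m.+1 *: (d m.+1 + v m.+1) =
  (a m - e) *: d m + (a m.+1 - s0) *: v m).
Context (mono : forall m, 0 <= b (v m.+1 - v m) (d m.+1)).

Let sg := s0 - s1.
Let k := sg / s0.
Let c := sg * ((e - s0) / (2 * e)).
Let P m := b (d m) (d m) + b (v m) (v m).
Let W m := b (v m.+1 - v m) (v m.+1 - v m).
Let p q m := a m *: (d m + v m) + e *: (x m - q).
Let energy q m := b (p q m) (p q m) + k * (a m ^+ 2 * b (d m) (d m)).

Let aS m : a m.+1 = a m + s1.
Proof. by rewrite /a -natr1; ring. Qed.

Let ea m : e <= a m.
Proof.
by apply: le_trans e_le _; rewrite lerDr; apply: mulr_ge0.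
Qed.

Let a_gt0 m : 0 < a m.
Proof. exact: lt_le_trans (ea m). Qed.

Let sg_gt0 : 0 < sg.
Proof. by rewrite /sg subr_gt0. Qed.

Let s0_gt0 : 0 < s0.
Proof. exact: le_lt_trans s1_lt. Qed.

Let k_gt0 : 0 < k.
Proof. exact: divr_gt0. Qed.

Let c_gt0 : 0 < c.
Proof. by apply: mulr_gt0 => //; rewrite divr_gt0 ?subr_gt0// mulr_gt0. Qed.

Let P_ge0 m : 0 <= P m.
Proof. by apply: addr_ge0; exact: hf_ge0. Qed.

Let rec_dot m h : a m.+1 * (b (d m.+1) h + b (v m.+1) h) =
  (a m - e) * b (d m) h + (a m.+1 - s0) * b (v m) h.
Proof. by rewrite -(hfDl hb) -(hfZl hb) rec !(hfE hb). Qed.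

(* The choice of [theta] and [gamma] makes the anchored momentum [p] move by a
   multiple of [v] only. *)
Lemma anchor_step q m : p q m.+1 = p q m - sg *: v m.
Proof.
apply: (hf_ext hb) => h; have := rec_dot m h.
by rewrite /p xS !(hfE hb) /sg aS; lra.
Qed.

(** The recursion is arranged so that the left side pairs the new velocity with the increment of
    [v]; by [mono] the cross term of its square is nonnegative. *)
Lemma momentum_step m :
  a m.+1 *: d m.+1 + a m.+1 *: (v m.+1 - v m) =
  a m *: d m - (e *: d m + s0 *: v m).
Proof.
by apply: (hf_ext hb) => h; have := rec_dot m h; rewrite !(hfE hb); lra.
Qed.

Lemma velocity_step m :
  a m.+1 *: (d m.+1 + v m.+1) =
  a m *: (d m + v m) - (e *: d m + sg *: v m).
Proof.
apply: (hf_ext hb) => h; have := rec_dot m h.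
by rewrite !(hfE hb) /sg aS; lra.
Qed.

Lemma sqr_velocity_step m : a m.+1 ^+ 2 * b (d m.+1) (d m.+1) + a m.+1 ^+ 2 * W m <=
  a m ^+ 2 * b (d m) (d m) - 2 * a m * (e * b (d m) (d m) + s0 * b (v m) (d m))
  + (e ^+ 2 * b (d m) (d m) + 2 * e * s0 * b (v m) (d m) + s0 ^+ 2 * b (v m) (v m)).
Proof.
have := congr1 (fun u => b u u) (momentum_step m).
have h : 0 <= a m.+1 ^+ 2 * b (v m.+1 - v m) (d m.+1).
  by apply: mulr_ge0 => //; exact: sqr_ge0.
rewrite [b (_ - (_ + _)) _](_ : _ = a m ^+ 2 * b (d m) (d m) -
  2 * a m * (e * b (d m) (d m) + s0 * b (v m) (d m))
  + (e ^+ 2 * b (d m) (d m) + 2 * e * s0 * b (v m) (d m) + s0 ^+ 2 * b (v m) (v m)));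
  last by rewrite !(hfE hb) (hfC hb (d m) (v m)); ring.
move=> <-.
rewrite [leRHS](_ : _ = a m.+1 ^+ 2 * b (d m.+1) (d m.+1) + a m.+1 ^+ 2 * W m
  + 2 * (a m.+1 ^+ 2 * b (v m.+1 - v m) (d m.+1))); first by lra.
rewrite (hf_sqrD hb) !(hfZl hb) !(hfZr hb) /W.
by rewrite (hfC hb (d m.+1) (v m.+1 - v m)); ring.
Qed.

(** Add [k] times [sqr_velocity_step] to the bound on the anchored momentum. Since [k * s0 = sg],
    both contributions carry the same multiple of <v, d>, and the remaining quadratic form in [d m]
    and [v m] is the one bounded by [energy_form_ge]. *)
Lemma energy_descent q m : 0 <= b (v m) (x m.+1 - q) ->
  energy q m.+1 + (k * (a m.+1 ^+ 2 * W m) + c * (a m * P m)) <= energy q m.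
Proof.
move=> zero.
have ke : k * e = sg * (e / s0) by rewrite /k mulrAC mulrA.
have ks : k * s0 = sg by rewrite /k divfK ?gt_eqF.
(* Writing [x m - q] as [x m.+1 - q - d m] turns the coefficient [a m] of <v, d> into [a m - e] and
   leaves a term whose sign is given by [zero]. *)
have vp : b (p q m.+1) (p q m.+1) <= b (p q m) (p q m)
    - 2 * sg * ((a m - e) * b (v m) (d m) + a m * b (v m) (v m))
    + sg ^+ 2 * b (v m) (v m).
  have : 0 <= 2 * sg * e * b (v m) (x m.+1 - q).
    by apply: mulr_ge0 => //; rewrite !mulr_ge0// ltW.
  rewrite anchor_step (hf_sqrD hb) (hf_sqrN hb) (hf_sqrZ hb) {3}/p xS.
  by rewrite !(hfE hb) (hfC hb (x m) (v m)) (hfC hb (d m) (v m)) (hfC hb q (v m)); lra.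
have := sqr_velocity_step m; rewrite -(ler_pM2l k_gt0) => vd.
have X0 := hf_ge0 hb (d m); have Y0 := hf_ge0 hb (v m).
have h1 := hf_ge0 hb (v m + d m).
have h2 := hf_ge0 hb (v m + 2 *: d m).
have qE : e / s0 * s0 = e by rewrite divfK ?gt_eqF.
have cE : (e - s0) / (2 * e) * (2 * e) = e - s0 by rewrite divfK// gt_eqF// mulr_gt0.
have h1' : 0 <= b (d m) (d m) + b (v m) (v m) + 2 * b (v m) (d m).
  by move: h1; rewrite (hf_sqrD hb); lra.
have h2' : 0 <= 4 * b (d m) (d m) + b (v m) (v m) + 4 * b (v m) (d m).
  by move: h2; rewrite (hf_sqrD hb) (hf_sqrZ hb) (hfZr hb); lra.
have := energy_form_ge e_gt0 s1_ge0 s1_lt s0_lt (ea m) qE cE X0 Y0 h1' h2'.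
rewrite -/sg; set Q := (X in _ <= X -> _) => hQ.
have QE : Q = 2 * sg * ((a m - e) * b (v m) (d m) + a m * b (v m) (v m))
    - sg ^+ 2 * b (v m) (v m)
    + (2 * a m - e) * (k * e) * b (d m) (d m)
    + 2 * (a m - e) * (k * s0) * b (v m) (d m) - s0 * (k * s0) * b (v m) (v m).
  by rewrite /Q ke ks; ring.
rewrite /energy /c /P; move: hQ; rewrite QE; lra.
Qed.


Let energy_ge0 q m : 0 <= energy q m.
Proof.
apply: addr_ge0; first exact: hf_ge0.
apply: mulr_ge0; first exact: ltW.
by apply: mulr_ge0; [exact: sqr_ge0|exact: hf_ge0].
Qed.

Let aP_ge0 m : 0 <= a m * P m.
Proof. by apply: mulr_ge0 => //; exact: ltW. Qed.

Let aW_ge0 m : 0 <= a m.+1 ^+ 2 * W m.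
Proof. by apply: mulr_ge0; [exact: sqr_ge0|exact: hf_ge0]. Qed.

Lemma recursion_bounded_sums q : (forall m, 0 <= b (v m) (x m.+1 - q)) ->
  bounded_sums (fun m => a m * P m) /\
  bounded_sums (fun m => a m.+1 ^+ 2 * W m).
Proof.
move=> zero.
have bs := bounded_sums_descent (energy_ge0 q) (fun m => energy_descent (zero m)).
have kW m : 0 <= k * (a m.+1 ^+ 2 * W m) by apply: mulr_ge0 => //; exact: ltW.
have cP m : 0 <= c * (a m * P m) by apply: mulr_ge0 => //; exact: ltW.
split.
- have /bounded_sumsZ : 0 <= c^-1 by rewrite invr_ge0 ltW.
  move=> /(_ _ bs); apply: bounded_sums_le => m.
  by rewrite ler_pdivlMl// lerDr.
- have /bounded_sumsZ : 0 <= k^-1 by rewrite invr_ge0 ltW.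
  move=> /(_ _ bs); apply: bounded_sums_le => m.
  by rewrite ler_pdivlMl// lerDl.
Qed.

Let slack s := 2 + 2 * (e ^+ 2 + s ^+ 2) * (1 + e^-1).

Let slack_ge0 s : 0 <= slack s.
Proof.
rewrite addr_ge0// mulr_ge0 ?mulr_ge0 ?addr_ge0 ?sqr_ge0//.
by rewrite invr_ge0 ltW.
Qed.

(** With U = e d + s v, -2<y, U> <= |y|^2 + |U|^2, and both squares are multiples of [P m]. The last
    |U|^2 lacks the weight [a m]; since [e <= a m], restoring it costs the factor [e^-1] in
    [slack]. *)
Lemma cross_term_le m s y : b y y <= 2 * P m ->
  - (2 * a m * b y (e *: d m + s *: v m))
  + b (e *: d m + s *: v m) (e *: d m + s *: v m) <= slack s * (a m * P m).
Proof.
set U := e *: d m + s *: v m => yP.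
have UP : b U U <= 2 * (e ^+ 2 + s ^+ 2) * P m.
  apply: le_trans (hf_sqrD_le hb _ _) _; rewrite !(hf_sqrZ hb) /P.
  have h1 := mulr_ge0 (sqr_ge0 e) (hf_ge0 hb (v m)).
  have h2 := mulr_ge0 (sqr_ge0 s) (hf_ge0 hb (d m)).
  by move: h1 h2; lra.
set M := 2 * (e ^+ 2 + s ^+ 2) in UP *.
have M0 : 0 <= M by rewrite mulr_ge0// addr_ge0 ?sqr_ge0.
have h0 : 0 <= a m * b (y + U) (y + U) by rewrite mulr_ge0 ?(hf_ge0 hb)// ltW.
have h1 : a m * b y y <= a m * (2 * P m) by rewrite ler_pM2l.
have h2 : a m * b U U <= a m * (M * P m) by rewrite ler_pM2l.
have h3 : M * P m <= M * e^-1 * (a m * P m).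
  by rewrite -mulrA ler_wpM2l// ler_pdivlMl// ler_wpM2r.
move: h0; rewrite (hf_sqrD hb) /slack -/M.
by move: h1 h2 h3 UP; lra.
Qed.

Lemma recursion_cvg0 q : (forall m, 0 <= b (v m) (x m.+1 - q)) ->
  [/\ a m ^+ 2 * b (d m) (d m) @[m --> \oo] --> 0,
      a m ^+ 2 * b (d m + v m) (d m + v m) @[m --> \oo] --> 0
    & a m ^+ 2 * P m @[m --> \oo] --> 0].
Proof.
move=> zero; have [bs _] := recursion_bounded_sums zero.
have a0_gt0 : 0 < a0 by exact: lt_le_trans e_le.
have dP m : b (d m) (d m) <= 2 * P m.
  have := hf_ge0 hb (v m); have := hf_ge0 hb (d m); rewrite /P; lra.
have rP m : b (d m + v m) (d m + v m) <= 2 * P m by exact: hf_sqrD_le.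
have le2 m y : b y y <= 2 * P m -> a m ^+ 2 * b y y <= 2 * a m * (a m * P m).
  move=> yP; rewrite [leRHS](_ : _ = a m ^+ 2 * (2 * P m)); last by ring.
  by rewrite ler_wpM2l// sqr_ge0.
have dc : a m ^+ 2 * b (d m) (d m) @[m --> \oo] --> 0.
  apply: (@almost_monotone_cvg0 _ _ (fun m => a m * P m) (slack s0) 2 s1 a0) => //.
  - by move=> m; rewrite mulr_ge0 ?(hf_ge0 hb) ?sqr_ge0.
  - move=> m; have := sqr_velocity_step m.
    have := cross_term_le s0 (dP m); have := aW_ge0 m.
    rewrite !(hfE hb) (hfC hb (d m) (v m)); lra.
  - by move=> m; exact: le2.
have rc : a m ^+ 2 * b (d m + v m) (d m + v m) @[m --> \oo] --> 0.
  apply: (@almost_monotone_cvg0 _ _ (fun m => a m * P m) (slack sg) 2 s1 a0) => //.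
  - by move=> m; rewrite mulr_ge0 ?(hf_ge0 hb) ?sqr_ge0.
  - move=> m; have := cross_term_le sg (rP m).
    rewrite /= -(hf_sqrZ hb (a m.+1)) velocity_step.
    set U := e *: d m + sg *: v m.
    rewrite [b (_ - U) _](hf_sqrD hb) (hf_sqrN hb) (hf_sqrZ hb) (hfNr hb) (hfZl hb); lra.
  - by move=> m; exact: le2.
split => //.
(* As v = (d + v) - d, |v|^2 <= 2|d + v|^2 + 2|d|^2; adding |d|^2 gives the coefficients 2 and 3. *)
apply: (@squeeze_cvgr _ _ _ _ (fun=> 0) (fun m =>
    2 * (a m ^+ 2 * b (d m + v m) (d m + v m)) + 3 * (a m ^+ 2 * b (d m) (d m)))).
- apply: nearW => m; apply/andP; split; first by rewrite mulr_ge0 ?sqr_ge0.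
  have := hf_sqrD_le hb (d m + v m) (- d m); rewrite (hf_sqrN hb) addrAC subrr add0r.
  rewrite -(@ler_pM2l _ (a m ^+ 2)) ?exprn_gt0// /P; lra.
- exact: cvg_cst.
- rewrite (_ : 0 = 2 * 0 + 3 * 0); last by rewrite !mulr0 addr0.
  by apply: cvgD; apply: cvgM => //; exact: cvg_cst.
Qed.

(** e (x - q) is the anchored momentum minus r = a (d + v). The energy converges by monotonicity,
    the momentum stays bounded, and [r] tends to 0, so every term in the expansion of |e (x - q)|^2
    converges. *)
Lemma recursion_dist_cvg q : (forall m, 0 <= b (v m) (x m.+1 - q)) ->
  cvgn (fun m => b (x m - q) (x m - q)).
Proof.
move=> zero; have [dc rc _] := recursion_cvg0 zero.
have Emono : nonincreasing_seq (energy q).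
  apply/nonincreasing_seqP => m; apply: le_trans (energy_descent (zero m)).
  by rewrite lerDl addr_ge0// mulr_ge0// ltW.
have Ec : cvgn (energy q).
  apply: nonincreasing_is_cvgn => //.
  by exists 0 => _ [m _ <-]; exact: energy_ge0.
have pE m : b (p q m) (p q m) <= energy q 0%N.
  apply: le_trans (Emono _ _ (leq0n m)); rewrite lerDl; apply: mulr_ge0; first exact: ltW.
  by rewrite mulr_ge0 ?(hf_ge0 hb) ?sqr_ge0.
pose r m := a m *: (d m + v m).
have rr : b (r m) (r m) @[m --> \oo] --> 0.
  by rewrite (_ : (fun m => _) = (fun m => a m ^+ 2 * b (d m + v m) (d m + v m)))//;
    apply/funext => m; rewrite (hf_sqrZ hb).
have pr : b (p q m) (r m) @[m --> \oo] --> 0.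
  apply: (@cvg_of_sqr_le _ _ (fun m => energy q 0%N * b (r m) (r m))).
    by rewrite -(mulr0 (energy q 0%N)); apply: cvgM => //; exact: cvg_cst.
  move=> m; rewrite subr0; apply: le_trans (hf_cauchy_schwarz hb _ _) _.
  by apply: ler_wpM2r => //; exact: hf_ge0.
have -> : (fun m => b (x m - q) (x m - q)) = (fun m => (e ^+ 2)^-1 *
    (energy q m - k * (a m ^+ 2 * b (d m) (d m)) - 2 * b (p q m) (r m) + b (r m) (r m))).
  apply/funext => m; apply: (@mulfI _ (e ^+ 2)); first by rewrite expf_neq0// gt_eqF.
  rewrite mulVKf ?expf_neq0 ?gt_eqF// -(hf_sqrZ hb).
  have -> : e *: (x m - q) = p q m - r m by rewrite /p /r addrAC subrr add0r.
  by rewrite (hf_sqrD hb) (hf_sqrN hb) (hfNr hb) /energy; ring.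
apply: is_cvgM; first exact: is_cvg_cst.
apply: is_cvgD; last by apply/cvg_ex; exists 0.
apply: is_cvgB; last by apply: is_cvgM; [exact: is_cvg_cst|apply/cvg_ex; exists 0].
apply: is_cvgB => //.
by apply: is_cvgM; [exact: is_cvg_cst|apply/cvg_ex; exists 0].
Qed.

End Recursion.

(** * Positive definite operators and the forward-backward residual *)

Section HilbertSpace.
Context {R : realType} {H : completeNormedModType R}.
Context (dot : {dot H for @idfun R}).
Context (dot_norm : forall x : H, dot x x = `|x| ^+ 2).

Lemma dot_hilbert_form : hilbert_form dot.
Proof.
split.
- by move=> x y; rewrite hermC /= expr0 mul1r.
- by move=> x y z; rewrite linearDl.
- by move=> a x z; rewrite linearZl_LR.
- by move=> x; rewrite dot_norm sqr_ge0.
- move=> x; rewrite dot_norm => /eqP; rewrite sqrf_eq0 normr_eq0 => /eqP //.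
- move=> u uC.
  have /cauchy_cvgP/cvg_ex[l ul] : cauchy (u @ \oo).
    apply: cauchy_exP => eps eps0.
    have [|N NP] := uC (eps ^+ 2); first exact: exprn_gt0.
    exists (u N); exists N => // n /= Nn.
    have := NP N n (leqnn _) Nn; rewrite dot_norm -ball_normE /=.
    by rewrite ltr_pXn2r ?nnegrE// ltW.
  exists l.
  have /cvgr_dist_lt ul' := ul.
  have nc : `|u n - l| @[n --> \oo] --> 0.
    apply/cvgrPdist_lt => eps eps0; have := ul' _ eps0; apply: filterS => n.
    by rewrite sub0r normrN normr_id distrC.
  under eq_fun do rewrite dot_norm expr2.
  by rewrite -(mulr0 0); exact: cvgM.
Qed.

Let hd := dot_hilbert_form.

Lemma positive_definiteP (T : H -> H) : positive_definite dot T ->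
  exists2 c, 0 < c & forall x, c * `|x| ^+ 2 <= dot (T x) x.
Proof.
rewrite /positive_definite /rayleigh_inf; set S := [set _ | _ in _] => S0.
have SP x : x != 0 -> (ereal_inf S <= (dot (T x) x / `|x| ^+ 2)%:E)%E.
  by move=> x0; apply: ereal_inf_lbound; exists x.
have [c c0 cS] : exists2 c : R, 0 < c & (c%:E <= ereal_inf S)%E.
  move: S0; case: (ereal_inf S) => [r r0| _|]; last by [].
    by exists r; rewrite // -lte_fin.
  (* An infinite infimum, as on the trivial space, admits any positive constant. *)
  by exists 1; rewrite // leey.
exists c => // x; have [->|x0] := eqVneq x 0.
  by rewrite normr0 expr0n mulr0 (hfC hd) (hf0l hd).
have := le_trans cS (SP x x0); rewrite lee_fin ler_pdivlMr//.
by rewrite exprn_gt0// normr_gt0.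
Qed.

Lemma op_norm_le (T : {linear H -> H}) (C : R) :
  (op_norm T <= C%:E)%E -> forall x, `|T x| <= C * `|x|.
Proof.
move=> TC x; have [->|x0] := eqVneq x 0; first by rewrite linear0 !normr0 mulr0.
have nx : 0 < `|x| by rewrite normr_gt0.
have : (`|T (`|x|^-1 *: x)|%:E <= C%:E)%E.
  apply: le_trans TC; apply: ereal_sup_ubound; exists (`|x|^-1 *: x) => //=.
  by rewrite normrZ normfV normr_id mulVf// gt_eqF.
rewrite lee_fin linearZ normrZ normfV normr_id => h.
by rewrite -ler_pdivrMr// mulrC.
Qed.

Lemma bounded_opP (T : {linear H -> H}) : bounded_op T ->
  exists2 C, 0 <= C & forall x, `|T x| <= C * `|x|.
Proof.
rewrite /bounded_op => Tb.
have [C TC] : exists C : R, (op_norm T <= C%:E)%E.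
  move: Tb; case: (op_norm T) => [r _|//|_]; first by exists r.
  by exists 0; rewrite leNye.
exists `|C| => // x; apply: le_trans (op_norm_le TC x) _.
by rewrite ler_wpM2r// ler_norm.
Qed.

Lemma dot_le x y : dot x y <= `|x| * `|y|.
Proof.
apply: le_trans (ler_norm _) _.
rewrite -(@ler_pXn2r _ 2) ?nnegrE ?mulr_ge0//.
by rewrite real_normK ?num_real// exprMn -!dot_norm; exact: hf_cauchy_schwarz.
Qed.

Section PositiveOperator.
Context (T : {linear H -> H}).
Context (Tsa : self_adjoint dot T) (Tpd : positive_definite dot T).

(* By self-adjointness [dot_of dot T] is continuous in each variable for the
   norm of [H], so the norm limit of a Cauchy sequence for the form is also its
   limit for the form. *)
Lemma dot_of_hilbert_form : hilbert_form (dot_of dot T).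
Proof.
have [c c0 cT] := positive_definiteP Tpd.
have T0 x : 0 <= dot (T x) x.
  by apply: le_trans (cT x); rewrite mulr_ge0 ?sqr_ge0// ltW.
split; rewrite /dot_of.
- by move=> x y; rewrite Tsa (hfC hd).
- by move=> x y z; rewrite linearD (hfDl hd).
- by move=> a x z; rewrite linearZ (hfZl hd).
- exact: T0.
- move=> x Tx0; apply/eqP; rewrite -normr_eq0 -sqrf_eq0 eq_le sqr_ge0 andbT.
  by have := cT x; rewrite Tx0 pmulr_rle0.
- move=> u uC.
  have [|l ul] := @hf_complete _ _ _ hd u.
    move=> eps eps0; have [|N NP] := uC (c * eps); first exact: mulr_gt0.
    exists N => n m Nn Nm; rewrite -(ltr_pM2l c0).
    by apply: le_lt_trans (NP n m Nn Nm); rewrite dot_norm; exact: cT.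
  exists l; apply/cvgrPdist_lt => eps eps0.
  have e2 : 0 < eps / 2 by lra.
  have [N NP] := uC _ e2; exists N => // n /= Nn.
  rewrite sub0r normrN ger0_norm//; apply: (@le_lt_trans _ _ (eps / 2)); last by lra.
  set h := u n - l.
  have hc : dot (T h) (u n - u m) @[m --> \oo] --> dot (T h) h.
    have -> : (fun m => dot (T h) (u n - u m)) =
        (fun m => dot (u n) (T h) - dot (u m) (T h)).
      by apply/funext => m; rewrite (hfC hd) (hfDl hd) (hfNl hd).
    rewrite {2}/h (hfC hd _ (u n - l)) (hfDl hd) (hfNl hd).
    by apply: cvgB; [exact: cvg_cst|exact: (hf_cvg_dot hd)].
  have : 2 * dot (T h) h <= eps / 2 + dot (T h) h.
    clearbody h; have hc2 : 2 * dot (T h) (u n - u m) @[m --> \oo] --> 2 * dot (T h) h.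
      by apply: cvgM => //; exact: cvg_cst.
    apply: (ler_cvg_to hc2 (cvg_cst (eps / 2 + dot (T h) h))).
    exists N => // m /= Nm; have := NP n m Nn Nm; move: (u n - u m) => g.
    have := T0 (h - g); rewrite [T _]linearB (hfDl hd) (hfNl hd) !(hfDr hd) !(hfNr hd).
    by rewrite [dot (T g) h]Tsa (hfC hd g (T h)); lra.
  by lra.
Qed.

Let hT := dot_of_hilbert_form.

(** Only surjectivity of [T] is needed: by positive definiteness, pairing with [x] is bounded for
    the form of [T], and the vector representing it there is a preimage of [x]. *)
Lemma inv_opK x : T (inv_op T x) = x.
Proof.
have [c c0 cT] := positive_definiteP Tpd.
have [|||l lP] := @hf_riesz _ _ _ hT (dot x) (c^-1 * dot x x).
- by rewrite mulr_ge0 ?invr_ge0 ?(ltW c0)// (hf_ge0 hd).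
- by move=> a y z; rewrite !(hfE hd).
- move=> y; apply: le_trans (hf_cauchy_schwarz hd _ _) _.
  rewrite [leRHS]mulrAC [leRHS]mulrC; apply: ler_wpM2l; first exact: hf_ge0 hd _.
  by rewrite ler_pdivlMl// dot_norm; exact: cT.
have Tl : T l = x by apply: (hf_ext hd) => h; rewrite lP.
by apply: (@pinvK _ _ (fun=> 0) setT T); rewrite inE; exists l.
Qed.

Lemma norm_of_sqr x : norm_of dot T x ^+ 2 = dot_of dot T x x.
Proof. by rewrite sqr_sqrtr//; exact: (hf_ge0 hT). Qed.

(** This replaces the form of the inverse by that of [T] at a preimage, so that no algebraic
    property of [inv_op] has to be established. *)
Lemma norm_of_inv_sqr x :
  norm_of dot (inv_op T) x ^+ 2 = dot_of dot T (inv_op T x) (inv_op T x).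
Proof.
have -> : norm_of dot (inv_op T) x = Num.sqrt (dot_of dot T (inv_op T x) (inv_op T x)).
  by rewrite /norm_of /dot_of inv_opK (hfC hd).
by rewrite sqr_sqrtr//; exact: (hf_ge0 hT).
Qed.

End PositiveOperator.

(** Adjoining the pair [(x, u)] to the graph keeps it monotone. *)
Lemma maximally_monotoneP (A : H -> set H) x u : maximally_monotone dot A ->
  (forall y v, A y v -> 0 <= dot (u - v) (x - y)) -> A x u.
Proof.
move=> [Amono Amax] xu.
pose A' z := A z `|` [set q | z = x /\ q = u].
apply: (Amax A'); [|by move=> z w; left|by right].
move=> y1 y2 u1 u2 [A1|[-> ->]] [A2|[-> ->]].
- exact: Amono.
- by rewrite -opprB (hfNl hd) -[y1 - x]opprB (hfNr hd) opprK; exact: xu.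
- exact: xu.
- by rewrite subrr (hf0l hd).
Qed.

(** * Resolvent and residual in the geometry of [M] *)

Section ForwardBackward.
Context (L M : {linear H -> H}) (A : H -> set H) (B : H -> H) (lambda : R).
Context (Lsa : self_adjoint dot L) (Lpd : positive_definite dot L).
Context (Msa : self_adjoint dot M) (Mpd : positive_definite dot M).
Context (Amax : maximally_monotone dot A) (Bcoco : cocoercive dot L B).
Context (lambda_gt0 : 0 < lambda).
Let hM := dot_of_hilbert_form Msa Mpd.
Let hL := dot_of_hilbert_form Lsa Lpd.
Let G := residual lambda M A B.

(** Minty's theorem in the form of [M] is applied to lambda M^-1 A, whose graph is written as
    [A p (lambda^-1 *: M u)]. Existence guarantees that [xget] does not fall back on its default
    0. *)
Lemma resolventP z :
  A (resolvent lambda M A z) (lambda^-1 *: M (z - resolvent lambda M A z)).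
Proof.
have [||p Ap] := @minty _ _ _ (fun p u => A p (lambda^-1 *: M u)) z hM.
- move=> x u y v Ax Ay; have := Amax.1 _ _ _ _ Ax Ay.
  by rewrite -scalerBr -linearB (hfZl hd) pmulr_rge0// invr_gt0.
- move=> x u xu; apply: (maximally_monotoneP Amax) => y v Ayv.
  have := xu y (lambda *: inv_op M v); rewrite linearZ inv_opK// scalerA mulVf ?gt_eqF//.
  rewrite scale1r => /(_ Ayv); rewrite (hfDl hM) (hfNl hM) (hfZl hM) /dot_of inv_opK//.
  have -> : dot (M u) (x - y) = lambda * dot (lambda^-1 *: M u) (x - y).
    by rewrite (hfZl hd) mulVKf ?gt_eqF.
  by rewrite -mulrBr -(hfNl hd) -(hfDl hd) pmulr_rge0.
have : exists p, set_op_inv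
    (fun x => [set x + lambda *: inv_op M a | a in A x]) z p.
  exists p, (lambda^-1 *: M (z - p)) => //.
  have -> : inv_op M (lambda^-1 *: M (z - p)) = lambda^-1 *: (z - p).
    apply: (hf_ext hM) => h; rewrite /dot_of inv_opK//.
    by rewrite linearZ.
  by rewrite scalerA divff ?gt_eqF// scale1r addrC subrK.
move=> /(@xgetPex _ 0)[a Aa]; rewrite -/(resolvent lambda M A z) => zE.
have -> : z - resolvent lambda M A z = lambda *: inv_op M a.
  by rewrite -{1}zE addrAC subrr add0r.
by rewrite linearZ inv_opK// scalerA mulVf ?gt_eqF// scale1r.
Qed.

Lemma forward_backwardE z : forward_backward lambda M A B z = z - lambda *: G z.
Proof.
rewrite /G /residual scalerA divff ?gt_eqF// scale1r.
by rewrite opprB addrC subrK.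
Qed.

Lemma residual_graph z : A (forward_backward lambda M A B z) (M (G z) - B z).
Proof.
have := resolventP (z - lambda *: inv_op M (B z)).
rewrite -/(forward_backward lambda M A B z) addrAC linearB scalerBr.
rewrite [M (lambda *: _)]linearZ inv_opK// scalerA mulVf ?gt_eqF// scale1r.
by rewrite /G /residual linearZ.
Qed.

(** At a zero q, monotonicity between the graph points over the forward-backward image of q and over
    q itself gives 0 <= - lambda |G q|_M^2. *)
Lemma zeros_residual q : zeros (set_op_add A B) q <-> G q = 0.
Proof.
split => [[a Aa aB]|G0].
  apply: (hf_eq0 hM); apply/eqP; rewrite eq_le (hf_ge0 hM) andbT.
  have := Amax.1 _ _ _ _ (residual_graph q) Aa.
  have -> : M (G q) - B q - a = M (G q) by rewrite -addrA -opprD [B q + a]addrC aB subr0.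
  rewrite forward_backwardE addrAC subrr add0r (hfNr hd) (hfZr hd) oppr_ge0.
  by rewrite pmulr_rle0.
exists (- B q); last by rewrite addNr.
have := residual_graph q.
by rewrite forward_backwardE G0 scaler0 subr0 linear0 sub0r.
Qed.

(** Monotonicity of [A] and co-coercivity of [B] leave the cross term lambda <L c, g>, where L c = B
    x - B y. Completing the square |c - (lambda / 2) g|_L^2 absorbs it at the price lambda^2 / 4. *)
Lemma residual_cocoercive x y :
  lambda * dot_of dot M (G x - G y) (G x - G y)
    - lambda ^+ 2 / 4 * dot_of dot L (G x - G y) (G x - G y)
  <= dot_of dot M (G x - G y) (x - y).
Proof.
have := Amax.1 _ _ _ _ (residual_graph x) (residual_graph y).
have := Bcoco x y; rewrite (norm_of_inv_sqr Lsa Lpd).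
set c := inv_op L (B x - B y).
have cE : B x - B y = L c by rewrite /c inv_opK.
rewrite !forward_backwardE.
have -> : M (G x) - B x - (M (G y) - B y) = M (G x - G y) - L c.
  by rewrite -cE [M (_ - _)]linearB !opprD !opprK [LHS]addrACA.
have -> : x - lambda *: G x - (y - lambda *: G y) = x - y - lambda *: (G x - G y).
  by rewrite scalerBr !opprD !opprK [LHS]addrACA.
rewrite cE; move: (G x - G y) (x - y) => g u h1 h2.
have h3 := hf_ge0 hL (c - (lambda / 2) *: g).
move: h3; rewrite (hf_sqrD hL) (hf_sqrN hL) (hf_sqrZ hL) (hfNr hL) (hfZr hL).
move: h1 h2; rewrite (hfDl hd) (hfNl hd) !(hfDr hd) !(hfNr hd) !(hfZr hd).
by rewrite /dot_of => h1 h2 h3; lra.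
Qed.

(** With L c = B x - B y and n = |L c|, Cauchy-Schwarz for the form of [L] gives n^4 <= <L c, c> C
    n^2, while co-coercivity gives <L c, c> <= n |x - y|. The goal is multiplied by n^3 to match. *)
Lemma cocoercive_lipschitz (C : R) : 0 <= C ->
  (forall x, `|L x| <= C * `|x|) -> forall x y, `|B x - B y| <= C * `|x - y|.
Proof.
move=> C0 LC x y; have := Bcoco x y; rewrite (norm_of_inv_sqr Lsa Lpd).
set c := inv_op L (B x - B y) => h1.
have cE : B x - B y = L c by rewrite /c inv_opK.
set n := `|B x - B y|; have [->|n0] := eqVneq n 0; first exact: mulr_ge0.
have np : 0 < n by rewrite lt_def n0 normr_ge0.
rewrite -(ler_pM2r np) -(ler_pM2r (exprn_gt0 2 np)).
have h2 : n ^+ 2 ^+ 2 <= dot_of dot L c c * (C * n ^+ 2).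
  have -> : n ^+ 2 = dot_of dot L c (L c) by rewrite -dot_norm cE.
  apply: le_trans (hf_cauchy_schwarz hL _ _) _.
  apply: ler_wpM2l; first exact: (hf_ge0 hL).
  rewrite /dot_of; apply: le_trans (dot_le _ _) _.
  by rewrite dot_norm expr2 mulrA ler_wpM2r.
have h3 : dot_of dot L c c <= n * `|x - y| by apply: le_trans h1 (dot_le _ _).
have -> : n * n * n ^+ 2 = n ^+ 2 ^+ 2 by ring.
apply: le_trans h2 _.
rewrite [leRHS](_ : _ = n * `|x - y| * (C * n ^+ 2)); last by ring.
by apply: ler_wpM2r => //; rewrite mulr_ge0// sqr_ge0.
Qed.

End ForwardBackward.
End HilbertSpace.

(** * Rates and weak convergence *)

Section Rates.
Context {R : realType}.
Implicit Types (u P : nat -> R).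

Lemma o_n2_of_cvg u : n.+1%:R ^+ 2 * u n.+1 @[n --> \oo] --> 0 -> o_n2 u.
Proof.
move=> uc; apply/eqoP => eps eps0.
move/cvgrPdist_le : uc => /(_ _ eps0)[N _ NP].
(* Starting at [N.+1] excludes index 0, where the comparison sequence takes the value 0. *)
exists N.+1 => // -[//|n] /= Nn.
have n0 : 0 < (n.+1%:R : R) ^+ 2 by rewrite exprn_gt0.
have := NP n Nn; rewrite /= sub0r normrN normrM (ger0_norm (ltW n0)) => h.
by rewrite normfV (ger0_norm (ltW n0)) ler_pdivlMr// mulrC.
Qed.

(** A positive power annihilates the term of index 0, so nothing is asked of [u 0]. *)
Lemma summable_powS k u : (0 < k)%N -> (forall n, 0 <= u n.+1) ->
  bounded_sums (fun n => n.+1%:R ^+ k * u n.+1) -> summable_pow k u.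
Proof.
move=> k0 u0 bs; apply: bounded_sums_nneseries.
  move=> [|n]; first by rewrite expr0n eqn0Ngt k0 mul0r.
  by rewrite mulr_ge0// exprn_ge0.
exact: bounded_sums_cons.
Qed.

(** From [s <= a0] one gets s (n + 1) <= a n <= a (n + 1), so for [0 < s] the weight n + 1 is traded
    for [a n] at the cost of a factor 1 / s. *)
Lemma rates_of_le (s a0 C : R) P u (a := fun n => s * n%:R + a0) :
  0 < s -> s <= a0 -> 0 <= C -> (forall n, 0 <= P n) ->
  bounded_sums (fun n => a n * P n) -> a n ^+ 2 * P n @[n --> \oo] --> 0 ->
  (forall n, 0 <= u n.+1) -> (forall n, u n.+1 <= C * (P n + P n.+1)) ->
  o_n2 u /\ summable_pow 1 u.
Proof.
move=> s0 sa C0 P0 bs aP u0 uP.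
have as_ n : s * n.+1%:R <= a n by rewrite /a -natr1 mulrDr mulr1 lerD2l.
have aS n : a n <= a n.+1 by rewrite /a lerD2r ler_pM2l// ler_nat.
have sn n : 0 <= s * n.+1%:R by rewrite mulr_ge0// ltW.
have a0_ n : 0 <= a n by exact: le_trans (as_ n).
split.
- apply: o_n2_of_cvg.
  apply: (@squeeze_cvgr _ _ _ _ (fun=> 0) (fun n =>
    C / s ^+ 2 * (a n ^+ 2 * P n + a n.+1 ^+ 2 * P n.+1))).
  + apply: nearW => n; apply/andP; split; first by rewrite mulr_ge0 ?exprn_ge0.
    rewrite [leRHS]mulrAC ler_pdivlMr ?exprn_gt0// [leLHS]mulrAC -exprMn [_ * s]mulrC.
    apply: (@le_trans _ _ (a n ^+ 2 * (C * (P n + P n.+1)))).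
      apply: ler_pM => //; first by rewrite sqr_ge0.
      by rewrite ler_pXn2r ?nnegrE.
    rewrite mulrCA ler_wpM2l// mulrDr lerD2l ler_wpM2r//.
    by rewrite ler_pXn2r ?nnegrE.
  + exact: cvg_cst.
  + rewrite [X in _ --> X](_ : 0 = C / s ^+ 2 * (0 + 0)); last by rewrite addr0 mulr0.
    apply: cvgM; first exact: cvg_cst.
    apply: cvgD => //.
    by rewrite (cvg_shiftS (fun n => a n ^+ 2 * P n)).
- apply: summable_powS => //.
  have := bounded_sumsD bs (bounded_sums_behead _ bs).
  move=> /(_ (fun n => mulr_ge0 (a0_ n) (P0 n))).
  have /bounded_sumsZ : 0 <= C / s by rewrite divr_ge0// ltW.
  move=> /[apply]; apply: bounded_sums_le => n.
  rewrite expr1 [leRHS]mulrAC ler_pdivlMr// [leLHS]mulrAC [_ * s]mulrC.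
  apply: (@le_trans _ _ (a n * (C * (P n + P n.+1)))).
    by apply: ler_pM.
  by rewrite mulrCA ler_wpM2l// mulrDr lerD2l ler_wpM2r.
Qed.

End Rates.

(** * The algorithm as an iteration of a firmly nonexpansive map *)

Section Iteration.
Context {R : realType} {V : lmodType R} {b : V -> V -> R}.
Context (hb : hilbert_form b).
Context (T : V -> V) (e s0 s1 nu0 : R) (x z : nat -> V) (q : V).
Context (firm : forall y y', b (T y - T y') (T y - T y') <= b (T y - T y') (y - y')).
Context (Tq : T q = 0).
Context (e_gt0 : 0 < e) (nu0_ge0 : 0 <= nu0).
Context (s1_ge0 : 0 <= s1) (s1_lt : s1 < s0) (s0_lt : s0 < e).
Context (xS : forall m, x m.+1 = z m - T (z m)).
Context (zS : forall m, z m.+1 = x m.+1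
  + theta e s1 nu0 m.+1 *: (x m.+1 - x m) + gamma e s0 s1 nu0 m.+1 *: T (z m)).

Let a0 := e + s1 + nu0.
Let a m := s1 * m%:R + a0.
Let d m := x m.+1 - x m.
Let v m := T (z m).
Let P m := b (d m) (d m) + b (v m) (v m).

Lemma firm_nonexpansive y y' :
  b (T y - T y') (T y - T y') <= b (y - y') (y - y').
Proof.
have := firm y y'; move: (T y - T y') (y - y') => t u h.
have := hf_ge0 hb (u - t).
rewrite (hf_sqrD hb) (hf_sqrN hb) (hfNr hb) (hfC hb u t); lra.
Qed.

Let e_le : e <= a0.
Proof. by rewrite /a0 -addrA lerDl addr_ge0. Qed.

Let a_gt0 m : 0 < a m.
Proof. by apply: ltr_wpDl; [exact: mulr_ge0|exact: lt_le_trans e_le]. Qed.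

Let dS m : x m.+1 = x m + d m.
Proof. by rewrite /d addrC subrK. Qed.

(** Multiplication by [a m.+1] clears the denominators: theta becomes [a m - e] and gamma becomes
    [a m.+1 - s0]. *)
Let iteration_rec m : a m.+1 *: (d m.+1 + v m.+1) =
  (a m - e) *: d m + (a m.+1 - s0) *: v m.
Proof.
have nuE : e + nu s1 nu0 m.+2 = a m.+1 by rewrite /nu /a /a0 -!natr1; ring.
have an0 : a m.+1 != 0 by rewrite gt_eqF.
have -> : d m.+1 + v m.+1 =
    theta e s1 nu0 m.+1 *: d m + gamma e s0 s1 nu0 m.+1 *: v m.
  by rewrite /d /v [x m.+2]xS addrAC subrK zS addrC !addrA addNr add0r.
rewrite scalerDr !scalerA /theta /gamma nuE !mulrBr !mulr1 !mulrA.
rewrite ![a m.+1 * _ / _]mulrAC divff// !mul1r; congr (_ *: _ + _).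
by rewrite /a -!natr1; ring.
Qed.

(** The increment of [x] is that of [z] minus that of [v = T z], so this is firmness between
    consecutive [z]. *)
Let iteration_mono m : 0 <= b (v m.+1 - v m) (d m.+1).
Proof.
have -> : d m.+1 = (z m.+1 - z m) - (v m.+1 - v m).
  rewrite /d [x m.+2]xS [x m.+1]xS -/(v m) -/(v m.+1).
  by rewrite !opprD !opprK [LHS]addrACA.
by rewrite (hfDr hb) (hfNr hb) subr_ge0; exact: firm.
Qed.

Let iteration_zero q' m : T q' = 0 -> 0 <= b (v m) (x m.+1 - q').
Proof.
move=> Tq'; have := firm (z m) q'; rewrite Tq' subr0 -/(v m) => h.
have -> : x m.+1 - q' = (z m - q') - v m by rewrite xS addrAC.
by rewrite (hfDr hb) (hfNr hb) subr_ge0.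
Qed.

Lemma iteration_rates :
  [/\ bounded_sums (fun m => a m * P m),
      bounded_sums (fun m => a m.+1 ^+ 2 * b (v m.+1 - v m) (v m.+1 - v m))
    & a m ^+ 2 * P m @[m --> \oo] --> 0].
Proof.
have zero m := iteration_zero m Tq.
have [bP bW] := recursion_bounded_sums hb e_gt0 s1_ge0 s1_lt s0_lt e_le dS
  iteration_rec iteration_mono zero.
have [_ _ aP] := recursion_cvg0 hb e_gt0 s1_ge0 s1_lt s0_lt e_le dS
  iteration_rec iteration_mono zero.
by split.
Qed.

(** The recursion expresses a (d_(m+1) - d_m) through a (v_(m+1) - v_m) and unweighted multiples of
    [d m] and [v m], all square summable. *)
Lemma sqr_increment_le m : a m.+1 ^+ 2 * b (d m.+1 - d m) (d m.+1 - d m) <=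
  2 * (a m.+1 ^+ 2 * b (v m.+1 - v m) (v m.+1 - v m)
       + 2 * ((s1 + e) ^+ 2 + s0 ^+ 2) * P m).
Proof.
rewrite -!(hf_sqrZ hb).
have -> : a m.+1 *: (d m.+1 - d m) =
    - (a m.+1 *: (v m.+1 - v m) + ((s1 + e) *: d m + s0 *: v m)).
  apply: (hf_ext hb) => h; have := congr1 (b ^~ h) (iteration_rec m).
  have -> : a m.+1 = a m + s1 by rewrite /a -natr1; ring.
  by rewrite !(hfE hb); lra.
rewrite (hf_sqrN hb); apply: le_trans (hf_sqrD_le hb _ _) _.
rewrite ler_pM2l// lerD2l; apply: le_trans (hf_sqrD_le hb _ _) _.
rewrite !(hf_sqrZ hb) -mulrA ler_pM2l// /P mulrDr mulrDl mulrDl.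
have h1 := mulr_ge0 (sqr_ge0 s0) (hf_ge0 hb (d m)).
have h2 := mulr_ge0 (sqr_ge0 (s1 + e)) (hf_ge0 hb (v m)).
by lra.
Qed.

(** Carries the rate of [v m = T (z m)] over to any point whose distance to [z m] is of order |v m|,
    such as the next terms of [x] and [y]. *)
Lemma sqr_T_le m y (C : R) : b (y - z m) (y - z m) <= C * b (v m) (v m) ->
  b (T y) (T y) <= 2 * (C + 1) * b (v m) (v m).
Proof.
move=> yz; have -> : T y = (T y - T (z m)) + T (z m) by rewrite subrK.
apply: le_trans (hf_sqrD_le hb _ _) _; rewrite -mulrA ler_pM2l//.
rewrite mulrDl mul1r lerD2r; apply: le_trans yz.
exact: firm_nonexpansive.
Qed.

Lemma sqr_Tx_le m : b (T (x m.+1)) (T (x m.+1)) <= 4 * b (v m) (v m).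
Proof.
have -> : 4 = 2 * (1 + 1) :> R by ring.
apply: sqr_T_le; rewrite mul1r xS addrAC subrr add0r.
by rewrite (hf_sqrN hb).
Qed.

(** Since [e <= a m], this covers the case [s1 = 0] too, and so does the weak convergence. *)
Lemma iteration_v_cvg0 : b (v m) (v m) @[m --> \oo] --> 0.
Proof.
have [_ _ aP] := iteration_rates.
apply: (@squeeze_cvgr _ _ _ _ (fun=> 0) (fun m => (e ^+ 2)^-1 * (a m ^+ 2 * P m))).
- apply: nearW => m; rewrite (hf_ge0 hb)/= ler_pdivlMl ?exprn_gt0//.
  apply: ler_pM; rewrite ?sqr_ge0 ?(hf_ge0 hb)//.
    rewrite ler_pXn2r ?nnegrE ?(ltW (a_gt0 m)) ?(ltW e_gt0)//.
    by apply: le_trans e_le _; rewrite lerDr mulr_ge0.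
  by rewrite /P lerDr (hf_ge0 hb).
- exact: cvg_cst.
- rewrite [X in _ --> X](_ : 0 = (e ^+ 2)^-1 * 0); last by rewrite mulr0.
  by apply: cvgM => //; exact: cvg_cst.
Qed.

Lemma iteration_weak_cvg :
  exists2 l, T l = 0 & forall h, b (x n) h @[n --> \oo] --> b l h.
Proof.
have dist q' : T q' = 0 -> cvgn (fun m => b (x m - q') (x m - q')).
  move=> Tq'; exact: (recursion_dist_cvg hb e_gt0 s1_ge0 s1_lt s0_lt e_le dS
    iteration_rec iteration_mono (fun m => iteration_zero m Tq')).
have [K KP] : exists K, forall m, b (x m - q) (x m - q) <= K.
  have /cvg_seq_bounded/pinfty_ex_gt0[K _ KP] := dist q Tq.
  by exists K => m; apply: le_trans (ler_norm _) (KP _ _).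
have bx m : b (x m) (x m) <= 2 * (K + b q q).
  by rewrite -{1 2}(subrK q (x m)); apply: le_trans (hf_sqrD_le hb _ _) _;
    rewrite ler_pM2l// lerD2r.
have Tx0 : b (T (x n)) (T (x n)) @[n --> \oo] --> 0.
  rewrite -cvg_shiftS.
  apply: (@squeeze_cvgr _ _ _ _ (fun=> 0) (fun m => 4 * b (v m) (v m))).
  - by apply: nearW => m; rewrite (hf_ge0 hb) sqr_Tx_le.
  - exact: cvg_cst.
  - rewrite [X in _ --> X](_ : 0 = 4 * 0); last by rewrite mulr0.
    by apply: cvgM; [exact: cvg_cst|exact: iteration_v_cvg0].
apply: (opial (S := fun l => T l = 0) hb bx dist) => U uU oU l lP.
have Txc h : b (T (x n)) h @[n --> \oo] --> 0.
  rewrite -(hf0l hb h); apply: (hf_cvg_dot hb).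
  by under eq_fun do rewrite subr0.
have Txx : b (T (x n)) (x n - l) @[n --> \oo] --> 0.
  apply: (@cvg_of_sqr_le _ _ (fun n => b (T (x n)) (T (x n)) *
      (2 * (2 * (K + b q q) + b l l)))).
    rewrite [X in _ --> X](_ : 0 = 0 * (2 * (2 * (K + b q q) + b l l))); last by rewrite mul0r.
    by apply: cvgM => //; exact: cvg_cst.
  move=> n; rewrite subr0; apply: le_trans (hf_cauchy_schwarz hb _ _) _.
  apply: ler_wpM2l; first exact: (hf_ge0 hb).
  apply: le_trans (hf_sqrD_le hb _ _) _.
  by rewrite (hf_sqrN hb) ler_pM2l// lerD2r.
(* Demiclosedness: expanding firmness between [x n] and [l] gives |T l|^2 <= f n, and [f] tends to 0
   along [U] because T (x n) tends to 0 strongly and x n tends to l weakly. *)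
pose f n := (2 * b (T (x n)) (T l) + b (T (x n)) (x n - l)) - (b (x n) (T l) - b l (T l)).
have fc : f n @[n --> U] --> 0.
  rewrite [X in _ --> X](_ : 0 = (2 * 0 + 0) - (b l (T l) - b l (T l))); last by ring.
  apply: cvgB; last by apply: cvgB; [exact: lP|exact: cvg_cst].
  apply: cvgD; last by move=> D /Txx; exact: oU.
  apply: cvgM; first exact: cvg_cst.
  by move=> D /(Txc (T l)); exact: oU.
apply: (hf_eq0 hb); apply/eqP; rewrite eq_le (hf_ge0 hb) andbT.
apply: (ler_cvg_to (cvg_cst _) fc); apply: nearW => n.
have := firm (x n) l; have := hf_ge0 hb (T (x n)).
rewrite /f !(hfE hb) (hfC hb (T l) (T (x n))) (hfC hb (T l) (x n)).
by rewrite (hfC hb (T l) l); lra.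
Qed.

End Iteration.

(** Under (a), delta links the two forms: lambda <L u, u> <= 4 delta |u|^2 <= 4 w(1-w) <M u, u>.
    Condition (b) gives the bound even without the factor 4. *)
Lemma step_size_bound (R : realType) (H : completeNormedModType R)
    (dot : {dot H for @idfun R}) (dot_norm : forall x : H, dot x x = `|x| ^+ 2)
    (L M : {linear H -> H}) (lambda w : R) :
  0 < lambda -> 0 < w -> w < 1 ->
  (exists delta : R,
     [/\ 0 < delta,
         (lambda%:E * op_norm L <= (4 * delta)%:E)%E
       & positive_definite dot (fun u => M u - (delta / (w * (1 - w))) *: u)])
  \/ positive_definite dot (fun u => M u - (lambda / (w * (1 - w))) *: L u) ->
  positive_definite dot M ->
  forall u, lambda * dot_of dot L u u <= 4 * (w * (1 - w)) * dot_of dot M u u.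
Proof.
move=> lam0 w0 w1 cond Mpd u; have hd := dot_hilbert_form dot_norm.
have ww : 0 < w * (1 - w) by rewrite mulr_gt0 ?subr_gt0.
case: cond => [[delta [del0 Lb]]|] /(positive_definiteP dot_norm)[c c0 /(_ u)];
  rewrite (hfDl hd) (hfNl hd) (hfZl hd) => h;
  have cu := mulr_ge0 (ltW c0) (sqr_ge0 `|u|).
- have Lu : `|L u| <= 4 * delta / lambda * `|u|.
    apply: op_norm_le; rewrite [4 * delta / lambda]mulrC EFinM.
    by rewrite lee_pdivlMl.
  have h1 : lambda * dot (L u) u <= 4 * delta * dot u u.
    rewrite dot_norm expr2 mulrA -ler_pdivlMl//.
    apply: le_trans (dot_le dot_norm _ _) _.
    by rewrite mulrA ler_wpM2r// mulrA [_ * (4 * delta)]mulrC.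
  have : delta * dot u u <= w * (1 - w) * dot (M u) u.
    by rewrite -ler_pdivrMl// mulrA [_^-1 * _]mulrC; lra.
  by rewrite /dot_of; lra.
- have : lambda * dot (L u) u <= w * (1 - w) * dot (M u) u.
    by rewrite -ler_pdivrMl// mulrA [_^-1 * _]mulrC; lra.
  have [c' c'0 /(_ u) Mu] := positive_definiteP dot_norm Mpd.
  have M0 : 0 <= w * (1 - w) * dot (M u) u.
    rewrite mulr_ge0 ?(ltW ww)//; apply: le_trans Mu.
    by rewrite mulr_ge0 ?sqr_ge0// ltW.
  by rewrite /dot_of; lra.
Qed.

(** The bound on [L] costs w(1-w) in [residual_cocoercive]; the margin left above w is 1 - w(1-w) -
    w = (1-w)^2. *)
Lemma firm_step (R : realType) (H : completeNormedModType R)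
    (dot : {dot H for @idfun R}) (dot_norm : forall x : H, dot x x = `|x| ^+ 2)
    (L M : {linear H -> H}) (A : H -> set H) (B : H -> H) (lambda w : R)
    (G := residual lambda M A B) :
  self_adjoint dot L -> positive_definite dot L ->
  self_adjoint dot M -> positive_definite dot M ->
  maximally_monotone dot A -> cocoercive dot L B ->
  0 < lambda -> 0 < w -> w < 1 ->
  (forall u, lambda * dot_of dot L u u <= 4 * (w * (1 - w)) * dot_of dot M u u) ->
  forall x y,
    dot_of dot M ((w * lambda) *: G x - (w * lambda) *: G y)
      ((w * lambda) *: G x - (w * lambda) *: G y) <=
    dot_of dot M ((w * lambda) *: G x - (w * lambda) *: G y) (x - y).
Proof.
move=> Lsa Lpd Msa Mpd Amax Bco lam0 w0 w1 LM x y.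
have hM := dot_of_hilbert_form dot_norm Msa Mpd.
have := residual_cocoercive dot_norm Lsa Lpd Msa Mpd Amax Bco lam0 x y.
rewrite -/G -(scalerBr (w * lambda) (G x) (G y)); move: (G x - G y) => g h.
rewrite (hf_sqrZ hM) (hfZl hM) expr2 -mulrA ler_pM2l ?mulr_gt0//.
apply: le_trans h.
have g0 := hf_ge0 hM g.
have h1 : lambda * (lambda * dot_of dot L g g) <=
    lambda * (4 * (w * (1 - w)) * dot_of dot M g g) by rewrite ler_pM2l.
have h2 : 0 <= lambda * ((1 - w) ^+ 2 * dot_of dot M g g).
  by apply: mulr_ge0; [exact: ltW|apply: mulr_ge0 => //; exact: sqr_ge0].
by move: h1 h2; lra.
Qed.

(* If [s1 = 0] then [theta] and [gamma] are constant and the rates are false in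
   general (a skew-adjoint [A] with spectrum accumulating at 0); hence the
   premise [0 < s1] in front of them. *)
Theorem theorem2p1 (R : realType) (H : completeNormedModType R)
    (dot : {dot H for @idfun R})
    (dot_norm : forall x : H, dot x x = `|x| ^+ 2)
    (L M : {linear H -> H}) (A : H -> set H) (B : H -> H)
    (s1 s0 nu0 e lambda w : R)
    (zm1 xm1 : H) (x z v : nat -> H) :
  self_adjoint dot L -> positive_definite dot L ->
  self_adjoint dot M -> positive_definite dot M ->
  maximally_monotone dot A ->
  cocoercive dot L B ->
  zeros (set_op_add A B) !=set0 ->
  0 <= s1 -> 0 <= s0 -> 0 <= nu0 ->
  0 < e -> 0 < lambda -> 0 < w ->
  2 * s1 < s0 -> s0 < e -> w < 1 ->
  (exists delta : R,
     [/\ 0 < delta,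
         (lambda%:E * op_norm L <= (4 * delta)%:E)%E
       & positive_definite dot (fun u => M u - (delta / (w * (1 - w))) *: u)])
  \/ positive_definite dot (fun u => M u - (lambda / (w * (1 - w))) *: L u) ->
  crifba M A B e lambda w s0 s1 nu0 zm1 xm1 x z v ->
  let dx := fun n => x n - seq_prev xm1 x n in
  let y := fun n => x n + (1 - w^-1) *: v n in
  let G := residual lambda M A B in
  let sqM := fun u : H => norm_of dot M u ^+ 2 in
  (0 < s1 ->
   [/\ [/\ o_n2 (fun n => sqM (dx n.+1)),
           summable_pow 1 (fun n => sqM (dx n.+1))
         & summable_pow 2 (fun n => sqM (dx n.+1 - dx n))],
       [/\ o_n2 (fun n => sqM (v n)),
           summable_pow 1 (fun n => sqM (v n))
         & summable_pow 2 (fun n => sqM (v n.+1 - v n))],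
       o_n2 (fun n => sqM (G (x n))) /\ summable_pow 1 (fun n => sqM (G (x n))),
       o_n2 (fun n => sqM (y n.+1 - y n)) /\
         summable_pow 1 (fun n => sqM (y n.+1 - y n))
     & o_n2 (fun n => sqM (G (y n))) /\ summable_pow 1 (fun n => sqM (G (y n)))])
  /\
  (bounded_op M -> bounded_op L ->
   (exists2 xbar : H, zeros (set_op_add A B) xbar
      & weakly_cvg (prod_dot (dot_of dot M) (dot_of dot M))
          (fun n => (x n, y n)) (xbar, xbar))
   /\
   (0 < s1 ->
    exists ystar : nat -> H,
      [/\ forall n : nat, (0 < n)%N -> set_op_add A B (y n) (ystar n),
          o_n2 (fun n => sqM (ystar n))
        & summable_pow 1 (fun n => sqM (ystar n))])).
Proof.
move=> Lsa Lpd Msa Mpd Amax Bco Sne s10 s00 nu00 e0 lam0 w0 s1s0 s0e w1 cond iter.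
move=> dx y G sqM.
have hd := dot_hilbert_form dot_norm.
have hM := dot_of_hilbert_form dot_norm Msa Mpd.
have sqME u : sqM u = dot_of dot M u u by exact: norm_of_sqr.
have sqM_ge0 u : 0 <= sqM u by rewrite sqME (hf_ge0 hM).
pose T u := (w * lambda) *: G u.
have wl0 : 0 < w * lambda by exact: mulr_gt0.
have firm y1 y2 : dot_of dot M (T y1 - T y2) (T y1 - T y2) <=
    dot_of dot M (T y1 - T y2) (y1 - y2).
  apply: (firm_step dot_norm Lsa Lpd) => //.
  exact: (step_size_bound dot_norm).
have T0P q : T q = 0 <-> zeros (set_op_add A B) q.
  rewrite (zeros_residual dot_norm B Msa Mpd Amax lam0).
  rewrite /T -/G; split=> [/eqP|->]; last by rewrite scaler0.
  by rewrite scaler_eq0 gt_eqF//= => /eqP.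
have FBE u : forward_backward lambda M A B u = u - lambda *: G u.
  exact: forward_backwardE.
have xS n : x n.+1 = z n - T (z n).
  have [_ _ ->] := iter n; rewrite FBE /T -scalerA scalerBr addrA -scalerDl subrK.
  by rewrite scale1r.
have vS n : v n.+1 = T (z n).
  by have [-> _ _] := iter n.+1; rewrite /= xS opprB addrC subrK.
have zS n : z n.+1 = x n.+1 + theta e s1 nu0 n.+1 *: (x n.+1 - x n)
    + gamma e s0 s1 nu0 n.+1 *: T (z n).
  by have [_ -> _] := iter n.+1; rewrite /= vS.
have [q /T0P Tq] := Sne.
have s1s0' : s1 < s0 by lra.
have [bsP bsW cP] := iteration_rates hM firm Tq e0 nu00 s10 s1s0' s0e xS zS.
set a := fun m => s1 * m%:R + (e + s1 + nu0).
pose P m := dot_of dot M (x m.+1 - x m) (x m.+1 - x m) + sqM (v m.+1).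
have PE : (fun m => dot_of dot M (x m.+1 - x m) (x m.+1 - x m) +
    dot_of dot M (T (z m)) (T (z m))) = P.
  by apply/funext => m; rewrite /P sqME vS.
have P0 m : 0 <= P m by rewrite addr_ge0// (hf_ge0 hM).
have dP m : sqM (dx m.+1) <= P m by rewrite sqME /P lerDl.
have vP m : sqM (v m.+1) <= P m by rewrite /P lerDr (hf_ge0 hM).
have sqMZ c u : sqM (c *: u) = c ^+ 2 * sqM u by rewrite !sqME (hf_sqrZ hM).
have sqMD u1 u2 : sqM (u1 + u2) <= 2 * (sqM u1 + sqM u2).
  by rewrite !sqME; exact: hf_sqrD_le.
have sqMN u : sqM (- u) = sqM u by rewrite !sqME (hf_sqrN hM).
have rate u C : 0 < s1 -> 0 <= C -> (forall n, 0 <= u n) ->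
    (forall n, u n.+1 <= C * (P n + P n.+1)) -> o_n2 u /\ summable_pow 1 u.
  move=> s1p C0 u0 uP.
  apply: (@rates_of_le _ s1 (e + s1 + nu0) C P) => //; first by lra.
  - by apply: bounded_sums_le bsP => m; rewrite -PE.
  - by rewrite -PE.
have yE n : y n.+1 = z n - w^-1 *: v n.+1.
  by rewrite /y xS vS scalerBl scale1r addrA subrK.
have GT u : sqM (G u) = ((w * lambda) ^+ 2)^-1 * sqM (T u).
  by rewrite (sqMZ _ (G u)) mulKf// expf_neq0// gt_eqF.
have Tx n : sqM (T (x n.+1)) <= 4 * sqM (v n.+1).
  by rewrite !sqME vS; exact: sqr_Tx_le.
have Ty n : sqM (T (y n.+1)) <= 2 * (w^-1 ^+ 2 + 1) * sqM (v n.+1).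
  rewrite !sqME vS; apply: sqr_T_le => //.
  by rewrite yE vS addrAC subrr add0r (hf_sqrN hM) (hf_sqrZ hM).
have wli : 0 <= ((w * lambda) ^+ 2)^-1 by rewrite invr_ge0 sqr_ge0.
have sq2 (c : R) : 0 <= c ^+ 2 by exact: sqr_ge0.
have sum2 u g : 0 < s1 -> (forall n, 0 <= u n) -> bounded_sums g ->
    (forall m, a m.+1 ^+ 2 * u m.+1 <= g m) -> summable_pow 2 u.
  move=> s1p u0 bsg ug; have s2 : 0 <= (s1 ^+ 2)^-1 by rewrite invr_ge0.
  apply: summable_powS => //; apply: bounded_sums_le (bounded_sumsZ s2 bsg) => m.
  rewrite ler_pdivlMl ?exprn_gt0// mulrA -exprMn; apply: le_trans (ug m).
  apply: ler_wpM2r => //; rewrite ler_pXn2r ?nnegrE//.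
  - by rewrite lerDl; lra.
  - exact: mulr_ge0.
  - by rewrite addr_ge0 ?mulr_ge0//; lra.
(* The division by [e] turns unweighted [P m] into the summable [a m * P m]. *)
have K0 : 0 <= 2 * ((s1 + e) ^+ 2 + s0 ^+ 2) / e.
  by rewrite divr_ge0 ?(ltW e0)// mulr_ge0// addr_ge0.
split=> [s1p|Mb Lb].
  split.
  - have [] := rate (fun n => sqM (dx n.+1)) 1 s1p ler01 (fun n => sqM_ge0 _).
      by move=> n; rewrite mul1r; have := dP n.+1; have := P0 n; lra.
    split=> //; apply: (sum2 _ _ s1p (fun n => sqM_ge0 _) (bounded_sumsZ (ler0n R 2)
      (bounded_sumsD bsW (bounded_sumsZ K0 bsP)))) => m /=.
    rewrite sqME; apply: le_trans (sqr_increment_le hM e0 nu00 s10 xS zS m) _.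
    rewrite ler_pM2l// lerD2l -[leRHS]mulrA ler_wpM2l ?mulr_ge0 ?addr_ge0//.
    rewrite ler_pdivlMl// ler_wpM2r//; first by rewrite addr_ge0 ?(hf_ge0 hM).
    by rewrite addrA; have := mulr_ge0 s10 (ler0n R m); lra.
  - have [] := rate (fun n => sqM (v n)) 1 s1p ler01 (fun n => sqM_ge0 _).
      by move=> n; rewrite mul1r; have := vP n; have := P0 n.+1; lra.
    by split=> //; apply: (sum2 _ _ s1p (fun n => sqM_ge0 _) bsW) => m; rewrite sqME !vS.
  - apply: (rate _ (((w * lambda) ^+ 2)^-1 * 4)) => // [|n]; first exact: mulr_ge0.
    rewrite GT -mulrA ler_wpM2l//; apply: le_trans (Tx n) _.
    by have := vP n; have := P0 n.+1; lra.
  - apply: (rate _ (2 + 4 * (1 - w^-1) ^+ 2)) => // [|n].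
      by rewrite addr_ge0// mulr_ge0.
    have -> : y n.+2 - y n.+1 = dx n.+2 + (1 - w^-1) *: (v n.+2 - v n.+1).
      by rewrite /y /dx /= scalerBr opprD [LHS]addrACA.
    apply: le_trans (sqMD _ _) _; rewrite sqMZ.
    have h1 := sqMD (v n.+2) (- v n.+1); rewrite sqMN in h1.
    have h2 : (1 - w^-1) ^+ 2 * sqM (v n.+2 - v n.+1) <=
      (1 - w^-1) ^+ 2 * (2 * (P n.+1 + P n)).
      rewrite ler_wpM2l//; apply: le_trans h1 _.
      by rewrite ler_pM2l// lerD.
    by have := dP n.+1; have := P0 n; lra.
  - apply: (rate _ (((w * lambda) ^+ 2)^-1 * (2 * (w^-1 ^+ 2 + 1)))) => // [|n].
      by rewrite mulr_ge0// mulr_ge0// addr_ge0.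
    rewrite GT -mulrA ler_wpM2l//; apply: le_trans (Ty n) _.
    rewrite ler_wpM2l ?mulr_ge0 ?addr_ge0//.
    by have := vP n; have := P0 n.+1; lra.
have [CM CM0 MP] := bounded_opP Mb.
have [CL CL0 LP] := bounded_opP Lb.
have [c c0 cM] := positive_definiteP dot_norm Mpd.
split.
  have [l Tl xl] := iteration_weak_cvg hM firm Tq e0 nu00 s10 s1s0' s0e xS zS.
  exists l; first exact/T0P.
  move=> [h1 h2]; rewrite /prod_dot /=.
  have vc : dot_of dot M (v n) h2 @[n --> \oo] --> 0.
    rewrite -(hf0l hM h2); apply: (hf_cvg_dot hM); rewrite -cvg_shiftS.
    rewrite (_ : (fun n => _) = (fun n => dot_of dot M (T (z n)) (T (z n)))).
      exact: (iteration_v_cvg0 hM firm Tq e0 nu00 s10 s1s0' s0e xS zS).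
    by apply/funext => n; rewrite subr0 vS.
  apply: cvgD => //.
  rewrite (_ : (fun n => _) = (fun n => dot_of dot M (x n) h2
      + (1 - w^-1) * dot_of dot M (v n) h2)); last first.
    by apply/funext => n; rewrite /y (hfDl hM) (hfZl hM).
  rewrite -[X in _ --> X]addr0 -(mulr0 (1 - w^-1)).
  by apply: cvgD => //; apply: cvgM => //; exact: cvg_cst.
move=> s1p.
(* [y m.+1] is the forward-backward image of [z m], over which [residual_graph] supplies a point of
   [A]. [y 0] depends on the arbitrary [v 0] and need not lie in the domain of [A], whence the
   default 0. *)
pose ystar n := if n is m.+1 then M (G (z m)) - B (z m) + B (y m.+1) else 0.
exists ystar.
have yFB m : y m.+1 = forward_backward lambda M A B (z m).
  rewrite FBE yE vS /T scalerA mulrA mulVf ?gt_eqF// mul1r//.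
(* Split [ystar] into M (G (z m)) and B (y m.+1) - B (z m): boundedness of [M] controls the first,
   the Lipschitz bound on [B] the second, and [c^-1] converts ambient norms into norms of [M]. *)
have ystarP m : sqM (ystar m.+1) <= CM * (2 * (CM ^+ 2 * (c^-1 * ((w * lambda) ^+ 2)^-1)
    + CL ^+ 2 * (c^-1 * w^-1 ^+ 2))) * sqM (v m.+1).
  have sq_le (C p r : R) : 0 <= C -> 0 <= p -> p <= C * r -> p ^+ 2 <= C ^+ 2 * r ^+ 2.
    move=> C0 p0 pr; rewrite -exprMn ler_pXn2r ?nnegrE//.
    exact: le_trans pr.
  have normM u : `|u| ^+ 2 <= c^-1 * sqM u by rewrite ler_pdivlMl// sqME.
  set s := ystar m.+1; have sE : s = M (G (z m)) + (B (y m.+1) - B (z m)).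
    by rewrite /s /ystar addrAC -addrA.
  have h1 : sqM s <= CM * `|s| ^+ 2.
    rewrite sqME; apply: le_trans (dot_le dot_norm _ _) _.
    by rewrite expr2 mulrA ler_wpM2r.
  have h2 : `|s| ^+ 2 <= 2 * (`|M (G (z m))| ^+ 2 + `|B (y m.+1) - B (z m)| ^+ 2).
    by rewrite sE -!dot_norm; exact: hf_sqrD_le.
  have h3 := sq_le _ _ _ CM0 (normr_ge0 _) (MP (G (z m))).
  have h4 := sq_le _ _ _ CL0 (normr_ge0 _)
    (cocoercive_lipschitz dot_norm Lsa Lpd Bco CL0 LP (y m.+1) (z m)).
  have h5 : `|G (z m)| ^+ 2 <= c^-1 * ((w * lambda) ^+ 2)^-1 * sqM (v m.+1).
    by apply: le_trans (normM _) _; rewrite GT -vS mulrA.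
  have h6 : `|y m.+1 - z m| ^+ 2 <= c^-1 * w^-1 ^+ 2 * sqM (v m.+1).
    apply: le_trans (normM _) _.
    by rewrite yE addrAC subrr add0r sqMN (sqMZ _ (v m.+1)) mulrA.
  apply: le_trans h1 _; rewrite -mulrA ler_wpM2l//; apply: le_trans h2 _.
  move: (c^-1 * _) (c^-1 * w^-1 ^+ 2) h5 h6 => al be h5 h6.
  have h7 := ler_wpM2l (sq2 CM) h5; have h8 := ler_wpM2l (sq2 CL) h6.
  by move: h3 h4 h7 h8; lra.
set K := CM * _ in ystarP.
have K_ge0 : 0 <= K.
  have ci : 0 <= c^-1 by rewrite invr_ge0 ltW.
  apply: mulr_ge0 => //; apply: mulr_ge0 => //.
  by apply: addr_ge0; apply: mulr_ge0 => //; exact: mulr_ge0.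
have [] := rate (fun n => sqM (ystar n)) K s1p K_ge0 (fun n => sqM_ge0 _).
  move=> n; apply: le_trans (ystarP n) _; apply: ler_wpM2l => //.
  by have := vP n; have := P0 n.+1; lra.
move=> yo ys; split=> //.
case=> // m _; exists (M (G (z m)) - B (z m)) => //.
by rewrite yFB; exact: (residual_graph dot_norm).
Qed.
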